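(* Let $X$ be a real convex-transitive Banach space, $u\in S_X$, and suppose there is a bicontractive linear projection $P:X\to[u]$. Assume that (i) the set $\omega\text{-}\exp(B_X)$ of weakly exposed points of $B_X$ is norm-dense in $S_X$; and (ii) the set-valued map $u\circ J:(S_X,\omega)\to\mathcal{P}([-1,1])$, $x\mapsto\{g(u): g\in J(x)\}$, is upper semi-continuous at $u$, where $S_X$ carries the relative weak topology. Then $X$ is isometrically a Hilbert space.
   Context: $X$ is convex-transitive if $\overline{\mathrm{conv}}(\{T(y):T\in\mathcal{G}_X\})=B_X$ for every $y\in S_X$, where $\mathcal{G}_X$ is the group of surjective linear isometries. $P$ is bicontractive if $\|P\|\le1$ and $\|I-P\|\le1$. A point $x\in S_X$ is weakly exposed by $f\in S_{X^*}$ if every $(x_n)\subset B_X$ with $f(x_n)\to1$ converges weakly to $x$. The duality map is $J(x)=\{f\in S_{X^*}: f(x)=1\}$. A set-valued map $F$ from a topological space $T$ to subsets of $Y$ is upper semi-continuous at $t$ if for every open $V\supset F(t)$ there is an open neighbourhood $U$ of $t$ with $F(s)\subset V$ for all $s\in U$. *)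

(* Defs.v *)
From Stdlib Require Import Reals List.
Open Scope R_scope.

Record Banach := {
  carrier :> Type;
  zero : carrier;
  add : carrier -> carrier -> carrier;
  opp : carrier -> carrier;
  scal : R -> carrier -> carrier;
  norm : carrier -> R;
  add_assoc : forall x y z, add x (add y z) = add (add x y) z;
  add_comm : forall x y, add x y = add y x;
  add_zero : forall x, add x zero = x;
  add_opp : forall x, add x (opp x) = zero;
  scal_assoc : forall a b x, scal a (scal b x) = scal (a * b) x;
  scal_one : forall x, scal 1 x = x;
  scal_distr_l : forall a x y, scal a (add x y) = add (scal a x) (scal a y);
  scal_distr_r : forall a b x, scal (a + b) x = add (scal a x) (scal b x);
  norm_nonneg : forall x, 0 <= norm x;
  norm_eq_zero : forall x, norm x = 0 -> x = zero;
  norm_scal : forall a x, norm (scal a x) = Rabs a * norm x;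
  norm_triangle : forall x y, norm (add x y) <= norm x + norm y;
  complete : forall s : nat -> carrier,
    (forall eps, 0 < eps -> exists N, forall m n, (N <= m)%nat -> (N <= n)%nat ->
        norm (add (s m) (opp (s n))) < eps) ->
    exists l, forall eps, 0 < eps -> exists N, forall n, (N <= n)%nat ->
        norm (add (s n) (opp l)) < eps
}.

Arguments zero {b0}.
Arguments add {b0}.
Arguments opp {b0}.
Arguments scal {b0}.
Arguments norm {b0}.

Section Defs.
Variable X : Banach.

Definition sub (x y : X) : X := add x (opp y).

Definition ball_X (x : X) : Prop := norm x <= 1.
Definition sphere_X (x : X) : Prop := norm x = 1.

Definition is_linear (T : X -> X) : Prop :=
  (forall x y, T (add x y) = add (T x) (T y)) /\
  (forall a x, T (scal a x) = scal a (T x)).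

Definition is_surj_lin_isometry (T : X -> X) : Prop :=
  is_linear T /\ (forall x, norm (T x) = norm x) /\ (forall y, exists x, T x = y).

Inductive conv (A : X -> Prop) : X -> Prop :=
| conv_in : forall x, A x -> conv A x
| conv_comb : forall x y t, conv A x -> conv A y -> 0 <= t <= 1 ->
    conv A (add (scal t x) (scal (1 - t) y)).

Definition closure (A : X -> Prop) (z : X) : Prop :=
  forall eps, 0 < eps -> exists w, A w /\ norm (sub z w) < eps.

Definition convex_transitive : Prop :=
  forall y, sphere_X y ->
    forall z, closure (conv (fun w => exists T, is_surj_lin_isometry T /\ w = T y)) z
              <-> ball_X z.

Definition is_functional (f : X -> R) : Prop :=
  (forall x y, f (add x y) = f x + f y) /\
  (forall a x, f (scal a x) = a * f x) /\
  (exists C, forall x, Rabs (f x) <= C * norm x).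

Definition dual_sphere (f : X -> R) : Prop :=
  is_functional f /\
  (forall x, ball_X x -> Rabs (f x) <= 1) /\
  (forall eps, 0 < eps -> exists x, ball_X x /\ 1 - eps < Rabs (f x)).

Definition weak_conv (s : nat -> X) (x : X) : Prop :=
  forall f, is_functional f -> Un_cv (fun n => f (s n)) (f x).

Definition weakly_exposed_by (x : X) (f : X -> R) : Prop :=
  sphere_X x /\ dual_sphere f /\
  forall s : nat -> X, (forall n, ball_X (s n)) ->
    Un_cv (fun n => f (s n)) 1 -> weak_conv s x.

Definition weakly_exposed (x : X) : Prop := exists f, weakly_exposed_by x f.

Definition J (x : X) (f : X -> R) : Prop := dual_sphere f /\ f x = 1.

Definition uJ (u x : X) (r : R) : Prop := exists g, J x g /\ r = g u.

Definition weak_open (U : X -> Prop) : Prop :=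
  forall x, U x -> exists (fs : list (X -> R)) (eps : R),
    Forall is_functional fs /\ 0 < eps /\
    forall y, (forall f, In f fs -> Rabs (f y - f x) < eps) -> U y.

End Defs.

Definition R_open (V : R -> Prop) : Prop :=
  forall v, V v -> exists eps, 0 < eps /\ forall w, Rabs (w - v) < eps -> V w.

Definition usc_weak_at (X : Banach) (F : X -> R -> Prop) (t : X) : Prop :=
  forall V, R_open V -> (forall r, F t r -> V r) ->
    exists U, weak_open X U /\ U t /\
      forall s, sphere_X X s -> U s -> forall r, F s r -> V r.

Definition is_hilbert (X : Banach) : Prop :=
  exists ip : X -> X -> R,
    (forall x y, ip x y = ip y x) /\
    (forall x y z, ip (add x y) z = ip x z + ip y z) /\
    (forall a x y, ip (scal a x) y = a * ip x y) /\
    (forall x, 0 <= ip x x) /\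
    (forall x, norm x = sqrt (ip x x)).

(* Main.v *)
Require Import Defs.
From Stdlib Require Import Reals List Lra Lia Classical IndefiniteDescription.
Open Scope R_scope.

(** Write the projection as [P x = f x * u] and put [Q x = x - f x * u], so that [|Q x| <= |x|].

    Uniform convexity.  Let [c] be the asymptotic supremum of [|a - b|] over [a], [b] in the
    unit ball with [|a + b| -> 2].  Take a weakly exposed point close to [u], exposed by [h]:
    on small slices of [h] the functional [f] is almost constant, and by (ii) all support
    functionals of points of the slice exceed 1/2 at [u].  Let [r] be the asymptotic supremum
    of [|Q x|] on these slices.  By convex transitivity the functionals [f o T], for isometries
    [T], norm the space, and an extremal pair can be moved by an isometry to where [h + s k] is
    almost maximal, [k = f o T o Q] being chosen to almost norm some [Q x].  Its image under [Q]
    is a pair in the ball of radius [r] whose sum is almost of norm [2 r] and whose difference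
    is almost [c]; hence [c <= r c].  If [r] were 1, a weakly exposed point of the slice would
    be supported by a functional almost vanishing at [u], contradicting (ii).  So [c = 0].

    Consequently orbits are dense, and the best approximation coefficients along any unit vector
    [x] are limits of functionals [f o T] with [T x -> u].  Every unit vector thus carries a
    bicontractive projection, and the resulting duality form [B] has a symmetric zero set
    because best approximations are unique.

    Pythagoras.  If there is a third orthogonal vector, the symmetry of the zero set makes
    [a |-> B (x + a e) e / B (x + a e) x] a monotone multiplicative involution up to a constant,
    as in the fundamental theorem of projective geometry; so it is linear, and integrating it
    gives [|x + a e|^2 = 1 + a^2].  In a plane, isometries sending [x] near [e] produce in the
    limit a quarter turn, and since isometries do not increase areas the norm is Euclidean.
    Pythagoras' identity gives [|v + w|^2 = |v|^2 + 2 B v w + |w|^2], so [B] is symmetric. *)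

Declare Scope vec_scope.
Delimit Scope vec_scope with V.
Bind Scope vec_scope with carrier.
Notation "x + y" := (add x y) : vec_scope.
Notation "x - y" := (sub _ x y) : vec_scope.
Notation "a * x" := (scal a%R x) : vec_scope.
Notation "`| x |" := (norm x%V) (at level 0, x at level 99, format "`| x |").

(** * Linear combinations *)

Section LinearCombinations.
Context {X : Banach}.
Implicit Types x y : X.

Lemma add_zero_l x : add zero x = x.
Proof. rewrite add_comm; apply add_zero. Qed.

Lemma add_cancel_l x y z : add x y = add x z -> y = z.
Proof.
  intros E.
  assert (F : forall t, add (opp x) (add x t) = t).
  { intros t. rewrite add_assoc, (add_comm _ (opp x)), add_opp. apply add_zero_l. }
  rewrite <- (F y), <- (F z), E. reflexivity.
Qed.

Lemma scal_zero_l x : scal 0 x = zero.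
Proof.
  apply (add_cancel_l (scal 0 x)).
  rewrite <- scal_distr_r, add_zero. f_equal; ring.
Qed.

Lemma scal_zero_r (a : R) : scal a (zero : X) = zero.
Proof.
  apply (add_cancel_l (scal a zero)).
  rewrite <- scal_distr_l, !add_zero. reflexivity.
Qed.

Lemma opp_scal x : opp x = scal (-1) x.
Proof.
  apply (add_cancel_l x). rewrite add_opp.
  transitivity (add (scal 1 x) (scal (-1) x)); [|now rewrite scal_one].
  rewrite <- scal_distr_r. replace (1 + -1) with 0 by ring.
  symmetry; apply scal_zero_l.
Qed.

Inductive vexpr :=
| VVar (n : nat) | VZero | VAdd (a b : vexpr) | VOpp (a : vexpr) | VScal (r : R) (a : vexpr).

Fixpoint veval (env : list X) (e : vexpr) : X :=
  match e with
  | VVar n => nth n env zero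
  | VZero => zero
  | VAdd a b => add (veval env a) (veval env b)
  | VOpp a => opp (veval env a)
  | VScal r a => scal r (veval env a)
  end.

Fixpoint vcoef (e : vexpr) (n : nat) : R :=
  match e with
  | VVar m => if Nat.eqb m n then 1 else 0
  | VZero => 0
  | VAdd a b => vcoef a n + vcoef b n
  | VOpp a => - vcoef a n
  | VScal r a => r * vcoef a n
  end.

Fixpoint lin_comb (env : list X) (c : nat -> R) : X :=
  match env with
  | nil => zero
  | x :: l => add (scal (c 0%nat) x) (lin_comb l (fun n => c (S n)))
  end.

Fixpoint eq_upto (n : nat) (c d : nat -> R) : Prop :=
  match n with
  | O => True
  | S m => c 0%nat = d 0%nat /\ eq_upto m (fun k => c (S k)) (fun k => d (S k))
  end.

Lemma lin_comb_ext env : forall c d,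
  eq_upto (length env) c d -> lin_comb env c = lin_comb env d.
Proof.
  induction env as [|x l IH]; intros c d; simpl; [reflexivity|].
  intros [H0 H1]. rewrite H0. f_equal. now apply IH.
Qed.

Lemma eq_upto_pointwise n : forall c d, (forall k, c k = d k) -> eq_upto n c d.
Proof. induction n; simpl; auto. Qed.

Lemma lin_comb_zero env : lin_comb env (fun _ => 0) = zero.
Proof.
  induction env as [|x l IH]; simpl; [reflexivity|].
  rewrite IH, scal_zero_l. apply add_zero.
Qed.

Lemma lin_comb_add env : forall c d,
  lin_comb env (fun n => c n + d n) = add (lin_comb env c) (lin_comb env d).
Proof.
  induction env as [|x l IH]; intros c d; simpl; [now rewrite add_zero|].
  rewrite (IH (fun n => c (S n)) (fun n => d (S n))), scal_distr_r, !add_assoc.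
  f_equal. rewrite <- !add_assoc. f_equal. apply add_comm.
Qed.

Lemma lin_comb_scal env r : forall c,
  lin_comb env (fun n => r * c n) = scal r (lin_comb env c).
Proof.
  induction env as [|x l IH]; intros c; simpl; [now rewrite scal_zero_r|].
  rewrite (IH (fun n => c (S n))), scal_distr_l, scal_assoc. reflexivity.
Qed.

Lemma lin_comb_var env : forall m,
  lin_comb env (fun n => if Nat.eqb m n then 1 else 0) = nth m env zero.
Proof.
  induction env as [|x l IH]; intros [|m]; simpl; try reflexivity.
  - rewrite lin_comb_zero, add_zero. apply scal_one.
  - rewrite (IH m), scal_zero_l. apply add_zero_l.
Qed.

Lemma veval_lin_comb env e : veval env e = lin_comb env (vcoef e).
Proof.
  induction e as [n| |a IHa b IHb|a IHa|r a IHa]; simpl.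
  - symmetry; apply lin_comb_var.
  - symmetry; apply lin_comb_zero.
  - rewrite IHa, IHb, <- lin_comb_add. reflexivity.
  - rewrite IHa, opp_scal, <- lin_comb_scal.
    apply lin_comb_ext, eq_upto_pointwise. intros k; ring.
  - rewrite IHa, <- lin_comb_scal. reflexivity.
Qed.

Lemma veval_eq env e1 e2 :
  eq_upto (length env) (vcoef e1) (vcoef e2) -> veval env e1 = veval env e2.
Proof. intros H. rewrite !veval_lin_comb. now apply lin_comb_ext. Qed.

End LinearCombinations.

Ltac vec_mem x l :=
  match l with
  | nil => constr:(false)
  | x :: _ => constr:(true)
  | _ :: ?l' => vec_mem x l'
  end.

Ltac vec_atoms t l :=
  match t with
  | zero => l
  | add ?a ?b => let l' := vec_atoms a l in vec_atoms b l'
  | opp ?a => vec_atoms a l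
  | scal _ ?a => vec_atoms a l
  | _ => match vec_mem t l with
         | true => l
         | false => constr:(t :: l)
         end
  end.

Ltac vec_index x l :=
  match l with
  | x :: _ => constr:(O)
  | _ :: ?l' => let n := vec_index x l' in constr:(S n)
  end.

Ltac vec_reify t l :=
  match t with
  | zero => constr:(VZero)
  | add ?a ?b => let a' := vec_reify a l in let b' := vec_reify b l in constr:(VAdd a' b')
  | opp ?a => let a' := vec_reify a l in constr:(VOpp a')
  | scal ?r ?a => let a' := vec_reify a l in constr:(VScal r a')
  | _ => let n := vec_index t l in constr:(VVar n)
  end.

(* Compares the coefficients of each atom, leaving the scalar equations as goals. *)
Ltac vreduce :=
  unfold sub;
  match goal with
  | |- @eq (carrier ?X) ?s ?t =>
      let l0 := vec_atoms s (@nil (carrier X)) in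
      let l := vec_atoms t l0 in
      let s' := vec_reify s l in
      let t' := vec_reify t l in
      change (veval l s' = veval l t');
      apply veval_eq; cbn [eq_upto length vcoef Nat.eqb]; repeat split
  end.

Ltac vring := vreduce; ring.

Section Norm.
Context {X : Banach}.
Implicit Types x y z : X.

Lemma norm_zero : norm (zero : X) = 0.
Proof.
  rewrite <- (scal_zero_l (zero : X)), norm_scal, Rabs_R0. ring.
Qed.

Lemma norm_eq_scal x (a : R) y : x = (a * y)%V -> `|x| = Rabs a * `|y|.
Proof. intros ->; apply norm_scal. Qed.

Lemma norm_scal_nonneg (a : R) x : 0 <= a -> `|a * x| = a * `|x|.
Proof. intros Ha. now rewrite norm_scal, Rabs_pos_eq. Qed.

Lemma norm_le_add x y z : x = (y + z)%V -> `|x| <= `|y| + `|z|.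
Proof. intros ->; apply norm_triangle. Qed.

Lemma norm_opp x : norm (opp x) = `|x|.
Proof.
  rewrite (norm_eq_scal (opp x) (-1) x) by vring.
  rewrite Rabs_left by lra. ring.
Qed.

Lemma norm_sub_comm x y : `|x - y| = `|y - x|.
Proof. rewrite <- norm_opp. f_equal. vring. Qed.

Lemma norm_sub_le x y : `|x - y| <= `|x| + `|y|.
Proof. rewrite <- (norm_opp y). apply norm_triangle. Qed.

Lemma norm_le_sub_add x y : `|x| <= `|x - y| + `|y|.
Proof. apply norm_le_add. vring. Qed.

Lemma norm_sub_self x : `|x - x| = 0.
Proof. rewrite (norm_eq_scal _ 0 x) by vring. rewrite Rabs_R0. ring. Qed.

Lemma eq_of_norm_sub x y : `|x - y| = 0 -> x = y.
Proof.
  intros H. apply norm_eq_zero in H.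
  replace x with ((x - y) + y)%V by vring. rewrite H. apply add_zero_l.
Qed.

Lemma norm_pos x : x <> zero -> 0 < `|x|.
Proof.
  intros H. destruct (norm_nonneg _ x) as [h|h]; auto.
  exfalso. now apply H, norm_eq_zero.
Qed.

Lemma norm_normalize x : 0 < `|x| -> `|/ `|x| * x| = 1.
Proof.
  intros H. rewrite norm_scal_nonneg; [field; lra|].
  left; now apply Rinv_0_lt_compat.
Qed.

Lemma scal_normalize x : 0 < `|x| -> x = (`|x| * (/ `|x| * x))%V.
Proof. intros H. vreduce. field. lra. Qed.

End Norm.

Lemma exists_pos_le (a b : R) : 0 < a -> 0 < b -> exists d, 0 < d /\ d <= a /\ d <= b.
Proof.
  intros Ha Hb. exists (Rmin a b).
  split; [now apply Rmin_glb_lt|split; [apply Rmin_l|apply Rmin_r]].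
Qed.

Lemma exists_pos_lt_scaled (k e : R) : 0 <= k -> 0 < e -> exists d, 0 < d /\ k * d < e.
Proof.
  intros Hk He. exists (e / (k + 1)).
  assert (Hpos : 0 < e / (k + 1)) by (apply Rdiv_lt_0_compat; lra).
  assert (E : (k + 1) * (e / (k + 1)) = e) by (field; lra).
  split; nra.
Qed.

Lemma eq_of_abs_sub_lt (a b k : R) :
  0 <= k -> (forall eta, 0 < eta -> Rabs (a - b) < k * eta) -> a = b.
Proof.
  intros Hk H. apply Rminus_diag_uniq.
  destruct (Req_dec (a - b) 0) as [|Hne]; auto. apply Rabs_pos_lt in Hne.
  destruct (exists_pos_lt_scaled k (Rabs (a - b)) Hk Hne) as (d & Hd & Hkd).
  specialize (H d Hd). lra.
Qed.

(** * Functionals and isometries *)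

Section Functionals.
Context {X : Banach}.
Implicit Types (x y z u : X) (f g h : X -> R) (S T : X -> X).

Lemma functional_add f : is_functional X f -> forall x y, f (x + y)%V = f x + f y.
Proof. intros Hf. apply Hf. Qed.

Lemma functional_scal f : is_functional X f -> forall (a : R) x, f (a * x)%V = a * f x.
Proof. intros Hf. apply Hf. Qed.

Lemma functional_sub f x y : is_functional X f -> f (x - y)%V = f x - f y.
Proof.
  intros Hf. replace (x - y)%V with (x + (-1) * y)%V by vring.
  rewrite (functional_add f Hf), (functional_scal f Hf). ring.
Qed.

Lemma functional_zero f : is_functional X f -> f zero = 0.
Proof.
  intros Hf. rewrite <- (scal_zero_l (zero : X)), (functional_scal f Hf). ring.
Qed.

Lemma functional_bound f :
  is_functional X f -> exists C, 0 < C /\ forall x, Rabs (f x) <= C * `|x|.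
Proof.
  intros (_ & _ & C & HC). exists (Rabs C + 1). split.
  - pose proof (Rabs_pos C). lra.
  - intros x. specialize (HC x). pose proof (norm_nonneg _ x).
    pose proof (Rle_abs C). nra.
Qed.

Lemma functional_add_scal g h (s : R) :
  is_functional X g -> is_functional X h -> is_functional X (fun x => g x + s * h x).
Proof.
  intros Hg Hh.
  destruct (functional_bound g Hg) as (C & _ & HC).
  destruct (functional_bound h Hh) as (D & _ & HD).
  destruct Hg as (gadd & gscal & _), Hh as (hadd & hscal & _).
  split; [|split].
  - intros x y. rewrite gadd, hadd. ring.
  - intros a x. rewrite gscal, hscal. ring.
  - exists (C + Rabs s * D). intros x.
    eapply Rle_trans; [apply Rabs_triang|]. rewrite Rabs_mult.
    specialize (HC x). specialize (HD x). pose proof (Rabs_pos s). nra.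
Qed.

Definition dual_ball f : Prop := is_functional X f /\ forall x, Rabs (f x) <= `|x|.

Lemma dual_ball_le f x : dual_ball f -> f x <= `|x|.
Proof. intros (_ & Hf). eapply Rle_trans; [apply Rle_abs|apply Hf]. Qed.

Lemma dual_ball_sub_le f x y : dual_ball f -> f x - f y <= `|x - y|.
Proof.
  intros Hf. rewrite <- functional_sub by apply Hf. now apply dual_ball_le.
Qed.

Lemma dual_ball_of_bound f :
  (forall x y, f (x + y)%V = f x + f y) -> (forall a x, f (a * x)%V = a * f x) ->
  (forall x, Rabs (f x) <= `|x|) -> dual_ball f.
Proof.
  intros fadd fscal Hf. split; [split; [|split]|]; auto.
  exists 1. intros x. rewrite Rmult_1_l. auto.
Qed.

Lemma dual_ball_comp f T :
  dual_ball f -> is_linear X T -> (forall x, `|T x| <= `|x|) -> dual_ball (fun x => f (T x)).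
Proof.
  intros ((fadd & fscal & _) & Hf) (Tadd & Tscal) HT. apply dual_ball_of_bound.
  - intros x y. now rewrite Tadd, fadd.
  - intros a x. now rewrite Tscal, fscal.
  - intros x. now apply Rle_trans with (1 := Hf (T x)).
Qed.

Lemma dual_sphere_dual_ball f : dual_sphere X f -> dual_ball f.
Proof.
  intros (Hf & Hball & _). split; auto. intros x.
  destruct (classic (x = zero)) as [->|Hx].
  - rewrite functional_zero, norm_zero, Rabs_R0 by auto. lra.
  - apply norm_pos in Hx. rewrite (scal_normalize x Hx) at 1.
    rewrite (functional_scal f Hf), Rabs_mult, Rabs_pos_eq by lra.
    pose proof (norm_normalize x Hx) as Hunit.
    specialize (Hball (/ `|x| * x)%V). unfold ball_X in Hball.
    specialize (Hball ltac:(lra)). nra.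
Qed.

Lemma isometry_add T : is_surj_lin_isometry X T -> forall x y, T (x + y)%V = (T x + T y)%V.
Proof. intros HT. apply HT. Qed.

Lemma isometry_scal T :
  is_surj_lin_isometry X T -> forall (a : R) x, T (a * x)%V = (a * T x)%V.
Proof. intros HT. apply HT. Qed.

Lemma isometry_norm T : is_surj_lin_isometry X T -> forall x, `|T x| = `|x|.
Proof. intros HT. apply HT. Qed.

Lemma isometry_sub T x y : is_surj_lin_isometry X T -> T (x - y)%V = (T x - T y)%V.
Proof.
  intros HT. replace (x - y)%V with (x + (-1) * y)%V by vring.
  rewrite (isometry_add T HT), (isometry_scal T HT). vring.
Qed.

Lemma isometry_dist T x y : is_surj_lin_isometry X T -> `|T x - T y| = `|x - y|.
Proof. intros HT. rewrite <- isometry_sub by auto. now apply isometry_norm. Qed.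

Lemma isometry_comp S T :
  is_surj_lin_isometry X S -> is_surj_lin_isometry X T ->
  is_surj_lin_isometry X (fun x => S (T x)).
Proof.
  intros ((Sadd & Sscal) & Snorm & Ssurj) ((Tadd & Tscal) & Tnorm & Tsurj).
  split; [split|split].
  - intros x y. now rewrite Tadd, Sadd.
  - intros a x. now rewrite Tscal, Sscal.
  - intros x. now rewrite Snorm.
  - intros z. destruct (Ssurj z) as [y <-]. destruct (Tsurj y) as [x <-]. eauto.
Qed.

Lemma isometry_inverse T :
  is_surj_lin_isometry X T ->
  exists S, is_surj_lin_isometry X S /\ forall x, S (T x) = x.
Proof.
  intros HT. pose proof HT as ((Tadd & Tscal) & Tnorm & Tsurj).
  destruct (functional_choice _ Tsurj) as [S TS].
  assert (Tinj : forall x y, T x = T y -> x = y).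
  { intros x y E. apply eq_of_norm_sub.
    rewrite <- (isometry_dist T), E by auto. apply norm_sub_self. }
  exists S. split; [|intros x; apply Tinj, TS].
  split; [split|split].
  - intros x y. apply Tinj. now rewrite Tadd, !TS.
  - intros a x. apply Tinj. now rewrite Tscal, !TS.
  - intros x. now rewrite <- Tnorm, TS.
  - intros x. exists (T x). apply Tinj, TS.
Qed.

Lemma dual_ball_isometry f T :
  dual_ball f -> is_surj_lin_isometry X T -> dual_ball (fun x => f (T x)).
Proof.
  intros Hf (Tlin & Tnorm & _). apply dual_ball_comp; auto.
  intros x. rewrite Tnorm. lra.
Qed.

Definition residual u f x : X := (x - f x * u)%V.

(* [residual u f] is [I - P] for the bicontractive projection [P x = f x * u]. *)
Record bicontractive_coordinate u f : Prop := {
  coordinate_dual_ball : dual_ball f;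
  coordinate_unit : `|u| = 1;
  coordinate_self : f u = 1;
  residual_contractive : forall x, `|residual u f x| <= `|x| }.

Global Arguments coordinate_dual_ball {u f}.
Global Arguments coordinate_unit {u f}.
Global Arguments coordinate_self {u f}.
Global Arguments residual_contractive {u f}.

Lemma residual_linear u f : is_functional X f -> is_linear X (residual u f).
Proof.
  intros (fadd & fscal & _). unfold residual. split.
  - intros x y. rewrite fadd. vring.
  - intros a x. rewrite fscal. vring.
Qed.

Lemma functional_residual u f g x :
  is_functional X g -> g (residual u f x) = g x - f x * g u.
Proof. intros Hg. unfold residual. now rewrite functional_sub, (functional_scal g Hg). Qed.

Lemma residual_dist u f x y :
  `|u| = 1 -> `|x - y| <= `|residual u f x - residual u f y| + Rabs (f x - f y).
Proof.
  intros Hu. rewrite <- (Rmult_1_r (Rabs _)), <- Hu, <- norm_scal.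
  apply norm_le_add. unfold residual. vring.
Qed.

Lemma residual_idempotent u f x :
  bicontractive_coordinate u f -> residual u f (residual u f x) = residual u f x.
Proof.
  intros Hf. unfold residual at 1.
  rewrite functional_residual, (coordinate_self Hf) by apply (coordinate_dual_ball Hf). vring.
Qed.

Lemma residual_dilate u f x (t : R) :
  bicontractive_coordinate u f -> 0 <= t ->
  (1 + t) * `|residual u f x| <= `|x + t * residual u f x|.
Proof.
  intros Hf Ht. rewrite <- norm_scal_nonneg by lra.
  destruct (residual_linear u f (proj1 (coordinate_dual_ball Hf))) as [res_add res_scal].
  replace ((1 + t) * residual u f x)%V with (residual u f (x + t * residual u f x)%V)
    by (rewrite res_add, res_scal, residual_idempotent by auto; vring).
  apply (residual_contractive Hf).
Qed.

Lemma bicontractive_projection_coordinate u (P : X -> X) :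
  `|u| = 1 -> is_linear X P -> (forall x, P (P x) = P x) ->
  (forall y, (exists x, P x = y) <-> (exists a, y = scal a u)) ->
  (forall x, `|P x| <= `|x|) -> (forall x, `|x - P x| <= `|x|) ->
  exists f, bicontractive_coordinate u f.
Proof.
  intros Hu [Padd Pscal] Pidem Prange Pnorm Pres.
  assert (Pline : forall x, exists a, P x = (a * u)%V) by (intros x; apply Prange; eauto).
  destruct (functional_choice _ Pline) as [f Hf].
  assert (scal_inj : forall a b : R, (a * u)%V = (b * u)%V -> a = b).
  { intros a b E. apply Rminus_diag_uniq, NNPP. intros Hne. apply (Rabs_no_R0 _ Hne).
    rewrite <- (Rmult_1_r (Rabs _)), <- Hu, <- norm_scal.
    replace ((a - b) * u)%V with (a * u - b * u)%V by vring. rewrite E. apply norm_sub_self. }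
  exists f. split; auto.
  - apply dual_ball_of_bound.
    + intros x y. apply scal_inj. rewrite <- Hf, Padd, !Hf. vring.
    + intros a x. apply scal_inj. rewrite <- Hf, Pscal, Hf. vring.
    + intros x. specialize (Pnorm x). rewrite Hf, norm_scal, Hu in Pnorm. lra.
  - apply scal_inj. rewrite <- Hf.
    destruct (proj2 (Prange u)) as [x <-]; [exists 1; vring|]. rewrite Pidem. vring.
  - intros x. unfold residual. rewrite <- Hf. apply Pres.
Qed.

(* A functional bounded on the orbit of [z] is bounded on its closed convex hull, the ball. *)
Lemma convex_transitive_approx f z x eps :
  convex_transitive X -> is_functional X f -> `|z| = 1 -> `|x| <= 1 -> 0 < eps ->
  exists T, is_surj_lin_isometry X T /\ f x - eps < f (T z).
Proof.
  intros Htrans Hf Hz Hx Heps. apply NNPP. intros Hn.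
  assert (Horbit : forall T, is_surj_lin_isometry X T -> f (T z) <= f x - eps).
  { intros T HT. apply Rnot_lt_le. intros h. apply Hn. eauto. }
  assert (Hconv : forall w,
    conv X (fun w => exists T, is_surj_lin_isometry X T /\ w = T z) w -> f w <= f x - eps).
  { intros w Hw. destruct Hf as (fadd & fscal & _).
    induction Hw as [w (T & HT & ->)|a b t _ IHa _ IHb Ht]; auto.
    rewrite fadd, !fscal. nra. }
  destruct (functional_bound f Hf) as (C & HC & Hbound).
  destruct (exists_pos_lt_scaled C eps) as (d & Hd & HCd); [lra|auto|].
  destruct (proj2 (Htrans z Hz x) Hx d Hd) as (w & Hw & Hxw).
  specialize (Hconv w Hw). specialize (Hbound (x - w)%V).
  rewrite functional_sub in Hbound by auto.
  pose proof (Rle_abs (f x - f w)). nra.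
Qed.

Lemma convex_transitive_norming u f x eps :
  convex_transitive X -> bicontractive_coordinate u f -> 0 < eps ->
  exists T, is_surj_lin_isometry X T /\ `|x| - eps < f (T x).
Proof.
  intros Htrans Hf Heps. pose proof (coordinate_unit Hf) as Hu.
  pose proof (coordinate_dual_ball Hf) as [Hlin _].
  destruct (classic (x = zero)) as [->|Hx].
  - destruct (convex_transitive_approx f u u 1) as (T & HT & _); auto; try lra.
    exists T. split; auto.
    pose proof (dual_ball_isometry f T (coordinate_dual_ball Hf) HT) as [HfT _].
    rewrite norm_zero, (functional_zero _ HfT). lra.
  - apply norm_pos in Hx.
    destruct (exists_pos_lt_scaled `|x| eps) as (d & Hd & Hxd); [lra|auto|].
    destruct (convex_transitive_approx f (/ `|x| * x)%V u d) as (T & HT & HTx); auto.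
    { now apply norm_normalize. } { lra. }
    exists T. split; auto. rewrite (coordinate_self Hf) in HTx.
    rewrite (scal_normalize x Hx) at 2.
    rewrite (isometry_scal T HT `|x|), (functional_scal f Hlin `|x|). nra.
Qed.

End Functionals.

(** * Uniform convexity *)

(* [c] is the limit, as [d] tends to [0], of the supremum of [F] over the set [S d]. *)
Definition asymptotic_sup {T : Type} (S : R -> T -> Prop) (F : T -> R) (c : R) : Prop :=
  (forall eta, 0 < eta -> exists d, 0 < d /\ forall t, S d t -> F t < c + eta) /\
  (forall eta d, 0 < eta -> 0 < d -> exists t, S d t /\ c - eta < F t).

Lemma asymptotic_sup_exists {T : Type} (S : R -> T -> Prop) (F : T -> R) (m M : R) :
  (forall d, 0 < d -> exists t, S d t) ->
  (forall d t, 0 < d -> S d t -> m <= F t <= M) ->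
  exists c, m <= c <= M /\ asymptotic_sup S F c.
Proof.
  intros Hex HF.
  destruct (completeness (fun s => forall d, 0 < d -> exists t, S d t /\ s <= F t))
    as [c [c_upper c_least]].
  - exists M. intros s Hs. destruct (Hs 1 Rlt_0_1) as (t & Ht & Hle).
    apply HF in Ht; lra.
  - exists m. intros d Hd. destruct (Hex d Hd) as [t Ht].
    exists t. split; auto. now apply (HF d).
  - exists c. split; [split|split].
    + apply c_upper. intros d Hd. destruct (Hex d Hd) as [t Ht].
      exists t. split; auto. now apply (HF d).
    + apply c_least. intros s Hs. destruct (Hs 1 Rlt_0_1) as (t & Ht & Hle).
      apply HF in Ht; lra.
    + intros eta Heta. apply NNPP. intros Hn.
      assert (c + eta <= c); [|lra]. apply c_upper. intros d Hd.
      apply NNPP. intros Hnone. apply Hn. exists d. split; auto.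
      intros t Ht. apply Rnot_le_lt. intros h. apply Hnone. eauto.
    + intros eta d Heta Hd. apply NNPP. intros Hn.
      assert (c <= c - eta); [|lra]. apply c_least. intros s Hs.
      apply Rnot_lt_le. intros h. destruct (Hs d Hd) as (t & Ht & Hle).
      apply Hn. exists t. split; [auto|lra].
Qed.

Section ConvexityGap.
Context {X : Banach}.
Implicit Types a b x u : X.

Definition almost_aligned (d : R) (a b : X) : Prop :=
  `|a| <= 1 /\ `|b| <= 1 /\ 2 - d <= `|a + b|.

Definition gap_bound (c : R) : Prop :=
  forall eta, 0 < eta -> exists d, 0 < d /\
    forall a b, almost_aligned d a b -> `|a - b| < c + eta.

Definition least_gap (c : R) : Prop :=
  gap_bound c /\
  forall eta d, 0 < eta -> 0 < d -> exists a b, almost_aligned d a b /\ c - eta < `|a - b|.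

Lemma least_gap_exists (u : X) : `|u| = 1 -> exists c, 0 <= c /\ least_gap c.
Proof.
  intros Hu.
  destruct (asymptotic_sup_exists (fun d p => almost_aligned d (fst p) (snd p))
    (fun p => `|fst p - snd p|) 0 2) as (c & Hc & c_bound & c_approx).
  - intros d Hd. exists (u, u). split; [simpl; lra|split; simpl; [lra|]].
    rewrite (norm_eq_scal _ 2 u), Hu, Rabs_pos_eq by (vring || lra). lra.
  - intros d [a b] Hd (Ha & Hb & _). simpl in *. split; [apply norm_nonneg|].
    pose proof (norm_sub_le a b). lra.
  - exists c. split; [lra|split].
    + intros eta Heta. destruct (c_bound eta Heta) as (d & Hd & H).
      exists d. split; auto. intros a b Hab. exact (H (a, b) Hab).
    + intros eta d Heta Hd. destruct (c_approx eta d Heta Hd) as ([a b] & H). eauto.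
Qed.

Lemma gap_bound_scaled c M eta :
  0 <= c -> gap_bound c -> 0 <= M -> 0 < eta ->
  exists d, 0 < d /\ forall r a b, 0 <= r <= M -> `|a| <= r + d -> `|b| <= r + d ->
    2 * r - d <= `|a + b| -> `|a - b| < r * c + eta.
Proof.
  intros Hc Hgap HM Heta.
  destruct (exists_pos_lt_scaled (M + 1) (eta / 2)) as (e & He & HMe); [lra|lra|].
  destruct (Hgap e He) as (delta & Hdelta & Hmod).
  destruct (exists_pos_lt_scaled c (eta / 2)) as (d1 & Hd1 & Hcd); [lra|lra|].
  destruct (exists_pos_le 1 (eta / 8)) as (d2 & Hd2 & Hd2_one & Hd2_eta); [lra|lra|].
  destruct (exists_pos_le d2 (delta * eta / 24)) as (d3 & Hd3 & Hd32 & Hd3_delta); [lra|nra|].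
  destruct (exists_pos_le d1 d3) as (d & Hd & Hdd1 & Hdd3); auto.
  exists d. split; auto. intros r a b Hr Ha Hb Hab.
  set (D := r + d) in *.
  destruct (Rle_lt_dec D (eta / 4)) as [small|large].
  - pose proof (norm_sub_le a b). nra.
  - assert (HD : 0 < / D) by (apply Rinv_0_lt_compat; lra).
    assert (unscale : forall s t, s <= D * t -> / D * s <= t).
    { intros s t Hst. apply (Rmult_le_reg_l D); [lra|].
      rewrite <- Rmult_assoc, Rinv_r by lra. lra. }
    assert (Hlt : `|/ D * a - / D * b| < c + e).
    { apply Hmod. split; [|split].
      - rewrite norm_scal_nonneg by lra. apply unscale. lra.
      - rewrite norm_scal_nonneg by lra. apply unscale. lra.
      - rewrite <- scal_distr_l, norm_scal_nonneg by lra.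
        apply (Rmult_le_reg_l D); [lra|].
        rewrite <- Rmult_assoc, Rinv_r by lra. unfold D in *. nra. }
    rewrite (norm_eq_scal _ (/ D) (a - b)), Rabs_pos_eq in Hlt by (vring || lra).
    apply (Rmult_lt_compat_l D) in Hlt; [|lra].
    rewrite <- Rmult_assoc, Rinv_r in Hlt by lra. unfold D in *. nra.
Qed.

Definition uniformly_convex : Prop := gap_bound 0.

End ConvexityGap.

Arguments gap_bound X c : clear implicits.
Arguments least_gap X c : clear implicits.
Arguments uniformly_convex X : clear implicits.

Section Slices.
Context {X : Banach}.
Implicit Types (a b w x y : X) (f h k : X -> R).

Definition slice h (d : R) x : Prop := `|x| <= 1 /\ 1 - d <= h x.

Definition slice_limit h f (l : R) : Prop :=
  forall eta, 0 < eta -> exists d, 0 < d /\ forall x, slice h d x -> Rabs (f x - l) < eta.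

Lemma slice_mono h (d e : R) x : d <= e -> slice h d x -> slice h e x.
Proof. intros Hde [Hx Hhx]. split; [auto|lra]. Qed.

Lemma dual_ball_near_normalized h x w (e : R) :
  dual_ball h -> h w = 1 -> 0 < `|x| -> `|w - / `|x| * x| <= e -> `|x| * (1 - e) <= h x.
Proof.
  intros Hh Hw Hx Hwx. rewrite (scal_normalize x Hx) at 2.
  rewrite (functional_scal h (proj1 Hh)). apply Rmult_le_compat_l; [lra|].
  pose proof (dual_ball_sub_le h w (/ `|x| * x)%V Hh). lra.
Qed.

Lemma slice_near_normalized h x y w (t e d : R) :
  dual_ball h -> slice h e x -> `|y| <= 1 -> 0 <= t -> 2 * t + 3 * e <= d <= 1 ->
  0 < `|x + t * y| -> `|w| <= 1 -> `|w - / `|x + t * y| * (x + t * y)| <= e -> slice h d w.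
Proof.
  intros Hh [Hx Hhx] Hy Ht Hd Hv Hw Hwv. split; auto.
  set (v := (x + t * y)%V) in *.
  assert (Hhv : 1 - e - t <= h v).
  { pose proof (dual_ball_le h (opp y) Hh) as Hopp. rewrite norm_opp, opp_scal in Hopp.
    destruct Hh as ((hadd & hscal & _) & _). rewrite hscal in Hopp.
    unfold v. rewrite hadd, hscal. nra. }
  assert (Hv1 : `|v| <= 1 + t).
  { unfold v. rewrite norm_triangle, norm_scal_nonneg by auto. nra. }
  assert (He : 0 <= e) by (eapply Rle_trans; [apply norm_nonneg|exact Hwv]).
  assert (Hnormalized : 1 - d + e <= h (/ `|v| * v)%V).
  { rewrite (functional_scal h (proj1 Hh)). apply (Rmult_le_reg_l `|v|); auto.
    rewrite <- Rmult_assoc, Rinv_r by lra. nra. }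
  pose proof (dual_ball_sub_le h (/ `|v| * v)%V w Hh) as Hsub.
  rewrite norm_sub_comm in Hsub. lra.
Qed.

Lemma dual_sphere_slice h (d : R) : dual_sphere X h -> 0 < d -> exists x, slice h d x.
Proof.
  intros ((_ & hscal & _) & _ & Hsup) Hd. destruct (Hsup d Hd) as (x & Hx & Hhx).
  unfold ball_X in Hx. destruct (Rcase_abs (h x)) as [hneg|hpos].
  - exists ((-1) * x)%V. rewrite Rabs_left in Hhx by auto.
    split; [rewrite norm_scal, Rabs_left|rewrite hscal]; lra.
  - exists x. rewrite Rabs_right in Hhx by auto. split; lra.
Qed.

Definition residual_width (u : X) f h (r : R) : Prop :=
  asymptotic_sup (slice h) (fun x => `|residual u f x|) r.

Lemma convex_transitive_pair (phi : X -> R) (sigma eps : R) x a b :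
  convex_transitive X -> is_functional X phi -> (forall y, `|y| <= 1 -> phi y <= sigma) ->
  `|x| <= 1 -> `|a| <= 1 -> `|b| <= 1 -> 0 < `|a + b| -> 0 < eps ->
  exists T, is_surj_lin_isometry X T /\
    `|a + b| * (phi x - eps) - sigma <= phi (T a) /\
    `|a + b| * (phi x - eps) - sigma <= phi (T b).
Proof.
  intros Htrans Hphi Hsigma Hx Ha Hb Hab Heps.
  destruct (convex_transitive_approx phi (/ `|a + b| * (a + b))%V x eps)
    as (T & HT & HTab); auto.
  { now apply norm_normalize. }
  exists T. split; auto.
  pose proof HT as ((Tadd & Tscal) & Tnorm & _).
  pose proof Hphi as (phi_add & phi_scal & _).
  rewrite Tscal, Tadd, phi_scal, phi_add in HTab.
  assert (HTa : phi (T a) <= sigma) by (apply Hsigma; rewrite Tnorm; auto).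
  assert (HTb : phi (T b) <= sigma) by (apply Hsigma; rewrite Tnorm; auto).
  apply (Rmult_lt_compat_l `|a + b|) in HTab; auto.
  rewrite <- Rmult_assoc, Rinv_r in HTab by lra. lra.
Qed.

Lemma tilted_functional_le h k (r d : R) x :
  dual_ball h -> dual_ball k -> 0 < d -> 0 <= r ->
  (forall y, slice h d y -> k y <= r) -> `|x| <= 1 -> h x + d / 2 * k x <= 1 + d / 2 * r.
Proof.
  intros Hh Hk Hd Hr Hslice Hx.
  pose proof (dual_ball_le h x Hh). pose proof (dual_ball_le k x Hk).
  destruct (Rle_lt_dec (1 - d) (h x)) as [hin|hout]; [|nra].
  specialize (Hslice x (conj Hx hin)). nra.
Qed.

Lemma tilted_functional_slice h k (r d eps : R) x :
  dual_ball h -> dual_ball k -> 0 < d -> 0 <= r -> 8 * eps <= 1 -> `|x| <= 1 ->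
  1 + d / 2 * r - 4 * (d * eps) <= h x + d / 2 * k x -> slice h d x /\ r - 8 * eps <= k x.
Proof.
  intros Hh Hk Hd Hr Heps Hx Hmax.
  pose proof (dual_ball_le h x Hh). pose proof (dual_ball_le k x Hk).
  assert (d / 2 * k x <= d / 2 * 1) by (apply Rmult_le_compat_l; lra).
  assert (d / 2 * (8 * eps) <= d / 2 * 1) by (apply Rmult_le_compat_l; lra).
  assert (0 <= d / 2 * r) by (apply Rmult_le_pos; lra).
  split; [split; auto; lra|].
  apply (Rmult_le_reg_l (d / 2)); lra.
Qed.

(* Where [h + (d / 2) k] is almost maximal on the ball, [h] exceeds [1 - d], and [k] is then
   almost maximal on the slice. *)
Lemma convex_transitive_pair_slice h k (r d eps : R) x a b :
  convex_transitive X -> dual_ball h -> dual_ball k ->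
  0 < d <= 1 -> 0 < eps <= 1 / 8 -> 0 <= r ->
  (forall y, slice h d y -> k y <= r) ->
  slice h (d * eps / 2) x -> r - eps <= k x -> almost_aligned (d * eps / 2) a b ->
  exists T, is_surj_lin_isometry X T /\
    (slice h d (T a) /\ r - 8 * eps <= k (T a)) /\
    (slice h d (T b) /\ r - 8 * eps <= k (T b)).
Proof.
  intros Htrans Hh Hk Hd Heps Hr Hslice [Hx Hhx] Hkx (Ha & Hb & Hab).
  set (phi := fun y => h y + d / 2 * k y).
  set (p := d * eps / 2) in *. assert (Hp : 0 < p <= 1 / 16) by (unfold p; nra).
  assert (Hsup : forall y, `|y| <= 1 -> phi y <= 1 + d / 2 * r)
    by (intros y Hy; now apply tilted_functional_le).
  assert (Hphix : 1 + d / 2 * r - 2 * p <= phi x).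
  { assert (d / 2 * (r - eps) <= d / 2 * k x) by (apply Rmult_le_compat_l; lra).
    unfold phi, p in *. lra. }
  assert (Hphix2 : phi x <= 2).
  { pose proof (dual_ball_le h x Hh). pose proof (dual_ball_le k x Hk). unfold phi. nra. }
  destruct (convex_transitive_pair phi (1 + d / 2 * r) p x a b)
    as (T & HT & HTa & HTb); auto; try lra.
  { apply functional_add_scal; [apply Hh|apply Hk]. }
  assert (Hmax : 1 + d / 2 * r - 8 * p <= `|a + b| * (phi x - p) - (1 + d / 2 * r)).
  { assert (0 <= d / 2 * r) by (apply Rmult_le_pos; lra).
    assert ((2 - p) * (phi x - p) <= `|a + b| * (phi x - p))
      by (apply Rmult_le_compat_r; lra).
    assert (p * (phi x - p) <= p * 2) by (apply Rmult_le_compat_l; lra). lra. }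
  replace (8 * p) with (4 * (d * eps)) in Hmax by (unfold p; field).
  pose proof HT as (_ & Tnorm & _).
  exists T. split; [auto|split]; apply tilted_functional_slice; rewrite ?Tnorm; auto;
    unfold phi in *; lra.
Qed.

End Slices.

Section WeakTopology.
Context {X : Banach}.
Implicit Types (x y w : X) (f h : X -> R) (s : nat -> X) (U : X -> Prop).

Lemma weak_conv_eventually U s x :
  weak_open X U -> U x -> weak_conv X s x -> exists N, forall n, (N <= n)%nat -> U (s n).
Proof.
  intros HU Hx Hs. destruct (HU x Hx) as (fs & e & Hfs & He & Hnbhd).
  assert (H : exists N, forall n, (N <= n)%nat ->
            forall f, In f fs -> Rabs (f (s n) - f x) < e).
  { clear Hnbhd. induction Hfs as [|f l Hf _ (N & IH)].
    - exists 0%nat. intros n _ f [].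
    - destruct (Hs f Hf e He) as (M & HM).
      exists (Nat.max M N). intros n Hn g [<-|Hg].
      + apply HM. lia.
      + apply IH; auto; lia. }
  destruct H as (N & HN). exists N. auto.
Qed.

Lemma weak_conv_of_norm s x :
  (forall n, `|s n - x| < RinvN n) -> weak_conv X s x.
Proof.
  intros Hs f Hf e He. destruct (functional_bound f Hf) as (C & HC & Hbound).
  destruct (exists_pos_lt_scaled C e) as (d & Hd & HCd); [lra|auto|].
  destruct (RinvN_cv Hd) as (N & HN). exists N. intros n Hn.
  specialize (HN n Hn). specialize (Hs n). specialize (Hbound (s n - x)%V).
  unfold Rdist in *. rewrite <- functional_sub by auto.
  rewrite Rminus_0_r, Rabs_pos_eq in HN by (left; apply cond_pos). nra.
Qed.

Lemma weak_open_meets_dense (A : X -> Prop) U x eps :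
  (forall d, 0 < d -> exists w, A w /\ `|w - x| < d) ->
  weak_open X U -> U x -> 0 < eps -> exists w, A w /\ U w /\ `|w - x| < eps.
Proof.
  intros Hdense HU Hx Heps.
  destruct (functional_choice _ (fun n => Hdense (RinvN n) (cond_pos _))) as [s Hs].
  destruct (weak_conv_eventually U s x HU Hx) as [N HN].
  { apply weak_conv_of_norm. intros n. apply Hs. }
  destruct (RinvN_cv Heps) as (M & HM). exists (s (Nat.max N M)).
  split; [apply Hs|split; [apply HN; lia|]].
  eapply Rlt_trans; [apply Hs|]. specialize (HM (Nat.max N M) ltac:(lia)).
  unfold Rdist in HM. rewrite Rminus_0_r, Rabs_pos_eq in HM; [auto|left; apply cond_pos].
Qed.

Lemma weakly_exposed_slice w h U :
  weakly_exposed_by X w h -> weak_open X U -> U w ->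
  exists d, 0 < d /\ forall x, slice h d x -> U x.
Proof.
  intros (_ & Hh & Hexp) HU Hw. apply NNPP. intros Hn.
  assert (Hout : forall n, exists x, slice h (RinvN n) x /\ ~ U x).
  { intros n. apply NNPP. intros Hin. apply Hn. exists (RinvN n).
    split; [apply cond_pos|]. intros x Hx. apply NNPP. eauto. }
  destruct (functional_choice _ Hout) as [s Hs].
  destruct (weak_conv_eventually U s w HU Hw) as [N HN]; [|now apply (Hs N), HN].
  apply Hexp; [intros n; apply Hs|]. intros e He.
  destruct (RinvN_cv He) as (N & HN). exists N. intros n Hn'. specialize (HN n Hn').
  destruct (Hs n) as ((Hball & Hlow) & _).
  pose proof (dual_ball_le h (s n) (dual_sphere_dual_ball h Hh)).
  unfold Rdist in *. split_Rabs; lra.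
Qed.

Lemma functional_strip_weak_open f (l e : R) :
  is_functional X f -> weak_open X (fun y => Rabs (f y - l) < e).
Proof.
  intros Hf y Hy. exists (f :: nil), (e - Rabs (f y - l)).
  split; [auto|split]; [lra|].
  intros z Hz. specialize (Hz f (or_introl eq_refl)).
  replace (f z - l) with ((f z - f y) + (f y - l)) by ring.
  eapply Rle_lt_trans; [apply Rabs_triang|]. lra.
Qed.

Lemma weakly_exposed_slice_limit w h f :
  weakly_exposed_by X w h -> is_functional X f -> slice_limit h f (f w).
Proof.
  intros Hw Hf eta Heta.
  apply (weakly_exposed_slice w h (fun x => Rabs (f x - f w) < eta)); auto.
  - now apply functional_strip_weak_open.
  - rewrite Rminus_diag, Rabs_R0. auto.
Qed.

Lemma weakly_exposed_J w h : weakly_exposed_by X w h -> J X w h.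
Proof.
  intros Hw. pose proof Hw as (_ & Hh & _). split; auto.
  apply eq_of_abs_sub_lt with 2; [lra|]. intros eta Heta.
  destruct (weakly_exposed_slice_limit w h h Hw (proj1 Hh) eta Heta) as (d & Hd & Hlim).
  destruct (exists_pos_le d eta) as (e & He & Hed & Hee); auto.
  destruct (dual_sphere_slice h e Hh He) as [x Hx].
  specialize (Hlim x (slice_mono _ _ _ _ Hed Hx)). destruct Hx as [Hx Hhx].
  pose proof (dual_ball_le h x (dual_sphere_dual_ball h Hh)).
  split_Rabs; lra.
Qed.

End WeakTopology.

Section SliceArgument.
Context {X : Banach} (u : X) (f h : X -> R) (l : R).
Implicit Types a b v w x y : X.
Hypothesis X_transitive : convex_transitive X.
Hypothesis f_coordinate : bicontractive_coordinate u f.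
Hypothesis h_sphere : dual_sphere X h.
Hypothesis f_limit : slice_limit h f l.

Let Q := residual u f.

Let f_dual_ball : dual_ball f := coordinate_dual_ball f_coordinate.
Let f_functional : is_functional X f := proj1 f_dual_ball.
Let h_dual_ball : dual_ball h := dual_sphere_dual_ball h h_sphere.
Let Q_contractive : forall x, `|Q x| <= `|x| := residual_contractive f_coordinate.

Lemma residual_norming_functional x eps :
  0 < eps -> exists k, dual_ball k /\ (forall y, k y <= `|Q y|) /\ `|Q x| - eps < k x.
Proof.
  intros Heps.
  destruct (convex_transitive_norming u f (Q x) eps) as (T & HT & HTx); auto.
  pose proof (dual_ball_isometry f T f_dual_ball HT) as HfT.
  exists (fun y => f (T (Q y))). split; [|split; auto].
  - apply (dual_ball_comp (fun y => f (T y)) Q); auto. now apply residual_linear.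
  - intros y. now apply (dual_ball_le (fun z => f (T z))).
Qed.

Lemma residual_pair_exists (c r eta : R) :
  least_gap X c -> residual_width u f h r -> 0 <= r -> 0 < eta ->
  exists a b, `|Q a| < r + eta /\ `|Q b| < r + eta /\ 2 * r - eta < `|Q a + Q b| /\
    c - eta < `|Q a - Q b|.
Proof.
  intros [_ c_approx] [r_bound r_approx] Hr Heta.
  destruct (exists_pos_le (1 / 16) (eta / 40)) as (e & He & He16 & He_eta); [lra|lra|].
  destruct (r_bound e He) as (d1 & Hd1 & Hwidth).
  destruct (f_limit e He) as (d2 & Hd2 & Hosc).
  destruct (exists_pos_le d1 d2) as (d3 & Hd3 & Hd31 & Hd32); auto.
  destruct (exists_pos_le 1 d3) as (d & Hd & Hd_one & Hdd3); [lra|auto|].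
  assert (Hslice : forall y, slice h d y -> `|Q y| < r + e /\ Rabs (f y - l) < e).
  { intros y Hy. split; [apply Hwidth|apply Hosc]; apply slice_mono with (2 := Hy); lra. }
  assert (Hde : 0 < d * (2 * e) / 2) by nra.
  destruct (r_approx (e / 2) (d * (2 * e) / 2)) as (x & Hx & HQx); [lra|auto|].
  destruct (residual_norming_functional x (e / 2)) as (k & Hk & HkQ & Hkx); [lra|].
  destruct (c_approx e (d * (2 * e) / 2)) as (a & b & Hab & Hgap); auto.
  destruct (convex_transitive_pair_slice h k (r + e) d (2 * e) x a b)
    as (T & HT & (Ta_slice & Ta_k) & (Tb_slice & Tb_k)); auto; try lra.
  { intros y Hy. specialize (HkQ y). destruct (Hslice y Hy). lra. }
  { fold Q in HQx. lra. }
  destruct (Hslice (T a) Ta_slice) as [Ta_width Ta_f].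
  destruct (Hslice (T b) Tb_slice) as [Tb_width Tb_f].
  exists (T a), (T b). split; [lra|split; [lra|split]].
  - specialize (HkQ (T a + T b)%V). rewrite (functional_add k (proj1 Hk)) in HkQ.
    unfold Q in HkQ. rewrite (proj1 (residual_linear u f f_functional)) in HkQ.
    fold Q in HkQ. lra.
  - pose proof (residual_dist u f (T a) (T b) (coordinate_unit f_coordinate)) as Hdist.
    rewrite isometry_dist in Hdist by auto. fold Q in Hdist. split_Rabs; lra.
Qed.

Lemma gap_le_width_mul_gap (c r : R) :
  0 <= c -> least_gap X c -> residual_width u f h r -> 0 <= r ->
  c <= r * c.
Proof.
  intros Hc Hgap Hwidth Hr. apply le_epsilon. intros eps Heps.
  destruct (gap_bound_scaled c r (eps / 2) Hc (proj1 Hgap) Hr) as (d & Hd & Hscaled); [lra|].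
  destruct (exists_pos_le d (eps / 2)) as (eta & Heta & Heta_d & Heta_eps); [auto|lra|].
  destruct (residual_pair_exists c r eta Hgap Hwidth Hr Heta)
    as (a & b & Ha & Hb & Hsum & Hdiff).
  specialize (Hscaled r (Q a) (Q b)). lra.
Qed.

Hypothesis exposed_dense :
  forall y, sphere_X X y -> forall eps, 0 < eps -> exists w, weakly_exposed X w /\ `|w - y| < eps.
Variable d0 : R.
Hypothesis d0_range : 0 < d0 <= 1.
Hypothesis J_slice : forall x g, `|x| = 1 -> slice h d0 x -> J X x g -> 1 / 2 < g u.
Hypothesis l_half : 1 / 2 < l.

(* If [|x|] and [|Q x|] are almost 1, then moving [x] along [Q x] gives a point of the slice
   whose support functionals almost norm [Q x], hence almost vanish at [u]. *)
Lemma residual_width_lt_one (r : R) : residual_width u f h r -> r < 1.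
Proof.
  intros [_ r_approx]. apply Rnot_le_lt. intros Hr.
  set (t := d0 / 3). set (e := t / 16).
  assert (Ht : 0 < t <= 1 / 3) by (unfold t; lra).
  destruct (f_limit (l - 1 / 2)) as (d1 & Hd1 & Hosc); [lra|].
  destruct (exists_pos_le d1 e) as (d & Hd & Hdd1 & Hde); [auto|unfold e; lra|].
  destruct (r_approx e d) as (x & Hx & HQx); [unfold e; lra|auto|].
  assert (Hfx : 1 / 2 < f x).
  { specialize (Hosc x (slice_mono _ _ _ _ Hdd1 Hx)). split_Rabs; lra. }
  apply (slice_mono _ _ e) in Hx; auto. pose proof (Q_contractive x) as HQ1.
  pose proof (residual_dilate u f x t f_coordinate ltac:(lra)) as Hlow.
  fold Q in HQx, Hlow. set (v := (x + t * Q x)%V) in *.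
  assert (Hv : (1 + t) * (1 - e) <= `|v|) by nra.
  assert (Hv0 : 0 < `|v|) by (unfold e in *; nra).
  destruct (exposed_dense (/ `|v| * v)%V (norm_normalize v Hv0) e)
    as (w & (g & Hw) & Hwv); [unfold e; lra|].
  assert (Hwd : slice h d0 w).
  { apply (slice_near_normalized h x (Q x) w t e); auto.
    - destruct Hx. lra.
    - lra.
    - unfold e, t. lra.
    - right. apply Hw.
    - left. exact Hwv. }
  assert (Hgu : 1 / 2 < g u) by (apply (J_slice w); auto; [apply Hw|now apply weakly_exposed_J]).
  destruct (weakly_exposed_J w g Hw) as [Hg Hgw]. apply dual_sphere_dual_ball in Hg.
  assert (Hgv : `|v| * (1 - e) <= g v) by (apply (dual_ball_near_normalized g v w e); auto; lra).
  assert (Hgv' : g v = g x + t * g (Q x))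
    by (unfold v; now rewrite (functional_add g (proj1 Hg)), (functional_scal g (proj1 Hg))).
  pose proof (functional_residual u f g x (proj1 Hg)) as HgQ. fold Q in HgQ.
  assert (Hgx : g x <= 1) by (eapply Rle_trans; [apply (dual_ball_le g x Hg)|apply Hx]).
  assert (Hlarge : 3 / 4 <= g (Q x)).
  { assert ((1 + t) * (1 - e) * (1 - e) <= `|v| * (1 - e))
      by (apply Rmult_le_compat_r; [unfold e; lra|exact Hv]).
    assert (0 <= (1 + t) * (e * e)) by (apply Rmult_le_pos; nra).
    assert (e * t <= e * (1 / 3)) by (apply Rmult_le_compat_l; unfold e; lra).
    apply (Rmult_le_reg_l t); [lra|]. unfold e in *. lra. }
  assert (1 / 2 * (1 / 2) < f x * g u) by (apply Rmult_gt_0_lt_compat; lra).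
  lra.
Qed.

Lemma uniformly_convex_of_slices : uniformly_convex X.
Proof.
  destruct (least_gap_exists u (coordinate_unit f_coordinate)) as (c & Hc & Hgap).
  destruct (asymptotic_sup_exists (slice h) (fun x => `|Q x|) 0 1) as (r & Hr & Hwidth).
  { intros d Hd. now apply dual_sphere_slice. }
  { intros d x _ [Hx _]. pose proof (Q_contractive x). pose proof (norm_nonneg _ (Q x)). lra. }
  pose proof (gap_le_width_mul_gap c r Hc Hgap Hwidth (proj1 Hr)).
  pose proof (residual_width_lt_one r Hwidth).
  unfold uniformly_convex. replace 0 with c by nra. apply Hgap.
Qed.

End SliceArgument.

Lemma uniformly_convex_of_weakly_exposed {X : Banach} (u : X) (f : X -> R) :
  convex_transitive X -> bicontractive_coordinate u f ->
  (forall y, sphere_X X y -> forall eps, 0 < eps ->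
     exists x, weakly_exposed X x /\ `|x - y| < eps) ->
  usc_weak_at X (uJ X u) u ->
  uniformly_convex X.
Proof.
  intros Htrans Hf Hdense Husc. pose proof (coordinate_unit Hf) as Hu.
  pose proof (coordinate_dual_ball Hf) as Hball.
  destruct (Husc (fun r => 1 / 2 < r)) as (U & HU & HUu & HJ).
  { intros v Hv. exists (v - 1 / 2). split; [lra|]. intros w Hw. split_Rabs; lra. }
  { intros r (g & (_ & Hg) & ->). lra. }
  destruct (weak_open_meets_dense (weakly_exposed X) U u (1 / 2) (Hdense u Hu) HU HUu)
    as (w & (h & Hw) & HUw & Hwu); [lra|].
  destruct (weakly_exposed_slice w h U Hw HU HUw) as (d1 & Hd1 & Hslice).
  destruct (exists_pos_le 1 d1) as (d & Hd & Hd_one & Hdd1); [lra|auto|].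
  apply (uniformly_convex_of_slices u f h (f w)) with (d0 := d); auto.
  - apply Hw.
  - apply weakly_exposed_slice_limit; [auto|apply Hball].
  - intros x g Hx Hxd Hg. apply (HJ x); auto.
    + apply Hslice. now apply slice_mono with (2 := Hxd).
    + now exists g.
  - pose proof (dual_ball_sub_le f u w Hball) as H.
    rewrite (coordinate_self Hf), norm_sub_comm in H. lra.
Qed.

(** * Almost transitivity and the duality form *)

Section AlmostTransitivity.
Context {X : Banach}.
Implicit Types (x y u : X) (f : X -> R).

Definition almost_transitive : Prop := forall x y eps, `|x| = 1 -> `|y| = 1 -> 0 < eps ->
  exists T, is_surj_lin_isometry X T /\ `|T x - y| < eps.

Lemma dense_orbit u f x eps :
  convex_transitive X -> uniformly_convex X -> bicontractive_coordinate u f ->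
  `|x| = 1 -> 0 < eps -> exists T, is_surj_lin_isometry X T /\ `|T x - u| < eps.
Proof.
  intros Htrans Hconvex Hf Hx Heps. pose proof (coordinate_unit Hf) as Hu.
  pose proof (coordinate_dual_ball Hf) as Hball.
  destruct (Hconvex eps Heps) as (d & Hd & Hmod).
  destruct (convex_transitive_approx f x u d) as (T & HT & HTx); auto; [apply Hball|lra|].
  exists T. split; auto. pose proof HT as (_ & Tnorm & _).
  rewrite <- (Rplus_0_l eps). apply Hmod. split; [rewrite Tnorm; lra|split; [lra|]].
  pose proof (dual_ball_le f (T x + u)%V Hball) as Hsum.
  rewrite (functional_add f (proj1 Hball)), (coordinate_self Hf) in *. lra.
Qed.

Lemma uniformly_convex_almost_transitive u f :
  convex_transitive X -> uniformly_convex X -> bicontractive_coordinate u f ->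
  almost_transitive.
Proof.
  intros Htrans Hconvex Hf x y eps Hx Hy Heps.
  destruct (dense_orbit u f x (eps / 2)) as (S & HS & HSx); auto; [lra|].
  destruct (dense_orbit u f y (eps / 2)) as (T & HT & HTy); auto; [lra|].
  destruct (isometry_inverse T HT) as (T' & HT' & Tinv).
  exists (fun v => T' (S v)). split; [now apply isometry_comp|].
  rewrite <- (Tinv y), isometry_dist by auto.
  pose proof (norm_le_add (S x - T y) (S x - u) (u - T y) ltac:(vring)) as H.
  rewrite (norm_sub_comm u) in H. lra.
Qed.

End AlmostTransitivity.

Arguments almost_transitive X : clear implicits.

Section BestCoefficient.
Context {X : Banach}.
Implicit Types (x y u : X) (f phi : X -> R).

Definition best_coefficient x y (s : R) : Prop := forall t, `|y - s * x| <= `|y - t * x|.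

Lemma distance_to_line_continuous x y : continuity (fun t => `|y - t * x|).
Proof.
  intros t e He. simpl.
  destruct (exists_pos_lt_scaled `|x| e (norm_nonneg _ x) He) as (d & Hd & Hxd).
  exists d. split; auto. intros s (_ & Hs). unfold Rdist in *.
  assert (lipschitz : forall r r', `|y - r * x| <= `|y - r' * x| + Rabs (r' - r) * `|x|).
  { intros r r'. rewrite <- norm_scal. apply norm_le_add. vring. }
  pose proof (lipschitz s t) as Hst. pose proof (lipschitz t s) as Hts.
  rewrite Rabs_minus_sym in Hst. pose proof (norm_nonneg _ x).
  assert (Rabs (s - t) * `|x| <= d * `|x|) by (apply Rmult_le_compat_r; lra).
  apply Rabs_def1; lra.
Qed.

Lemma norm_le_sub_far x y (t : R) : `|x| = 1 -> 2 * `|y| <= Rabs t -> `|y| <= `|y - t * x|.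
Proof.
  intros Hx Ht. pose proof (norm_le_sub_add (t * x) y) as H.
  rewrite norm_sub_comm, norm_scal, Hx in H. lra.
Qed.

Lemma best_coefficient_exists x y : `|x| = 1 -> exists s, best_coefficient x y s.
Proof.
  intros Hx. pose proof (norm_nonneg _ y) as Hy.
  destruct (continuity_ab_min (fun t => `|y - t * x|) (-2 * `|y|) (2 * `|y|))
    as (s & Hmin & _); [lra|intros; apply distance_to_line_continuous|].
  exists s. intros t. destruct (Rle_lt_dec (Rabs t) (2 * `|y|)) as [near|far].
  - apply Hmin. split_Rabs; lra.
  - specialize (Hmin 0 ltac:(lra)). replace (y - 0 * x)%V with y in Hmin by vring.
    pose proof (norm_le_sub_far x y t Hx). lra.
Qed.

Lemma almost_best_coefficient_close M eta :
  uniformly_convex X -> 0 <= M -> 0 < eta ->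
  exists d, 0 < d /\ forall x y s s', `|x| = 1 -> `|y| <= M ->
    (forall t, `|y - s * x| <= `|y - t * x| + d) ->
    (forall t, `|y - s' * x| <= `|y - t * x| + d) -> Rabs (s - s') < eta.
Proof.
  intros Hconvex HM Heta.
  destruct (gap_bound_scaled (X := X) 0 (M + 1) eta) as (d0 & Hd0 & Hscaled); auto; try lra.
  destruct (exists_pos_le 1 (d0 / 2)) as (d & Hd & Hd_one & Hdd0); [lra|lra|].
  exists d. split; auto. intros x y s s' Hx Hy Hs Hs'.
  rewrite Rabs_minus_sym, <- (Rmult_1_r (Rabs _)), <- Hx, <- norm_scal.
  replace ((s' - s) * x)%V with ((y - s * x) - (y - s' * x))%V by vring.
  rewrite <- (Rplus_0_l eta), <- (Rmult_0_r `|y - s * x|).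
  apply Hscaled.
  - split; [apply norm_nonneg|]. specialize (Hs 0).
    replace (y - 0 * x)%V with y in Hs by vring. lra.
  - lra.
  - specialize (Hs' s). lra.
  - specialize (Hs ((s + s') / 2)).
    replace ((y - s * x) + (y - s' * x))%V with (2 * (y - ((s + s') / 2) * x))%V
      by (vreduce; field).
    rewrite norm_scal_nonneg by lra. lra.
Qed.

Lemma best_coefficient_unique x y s s' :
  uniformly_convex X -> `|x| = 1 -> best_coefficient x y s -> best_coefficient x y s' -> s = s'.
Proof.
  intros Hconvex Hx Hs Hs'. apply eq_of_abs_sub_lt with 1; [lra|]. intros eta Heta.
  destruct (almost_best_coefficient_close `|y| eta Hconvex (norm_nonneg _ y) Heta)
    as (d & Hd & Hclose).
  rewrite Rmult_1_l. apply (Hclose x y); auto; [lra| |]; intros t.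
  - specialize (Hs t). lra.
  - specialize (Hs' t). lra.
Qed.

Lemma coordinate_best u f y : bicontractive_coordinate u f -> best_coefficient u y (f y).
Proof.
  intros Hf t. pose proof (residual_contractive Hf (y - t * u)) as H.
  pose proof (coordinate_dual_ball Hf) as [Hlin _].
  unfold residual in H.
  rewrite (functional_sub f), (functional_scal f Hlin), (coordinate_self Hf) in H by auto.
  replace ((y - t * u) - (f y - t * 1) * u)%V with (y - f y * u)%V in H by vring.
  exact H.
Qed.

Lemma transported_coordinate_almost_best u f T x y t :
  bicontractive_coordinate u f -> is_surj_lin_isometry X T -> `|x| = 1 ->
  `|y - f (T y) * x| <= `|y - t * x| + 3 * `|y| * `|T x - u|.
Proof.
  intros Hf HT Hx. pose proof HT as ((Tadd & Tscal) & Tnorm & _).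
  assert (moderate : forall r, Rabs r <= 2 * `|y| ->
            `|y - f (T y) * x| <= `|y - r * x| + 3 * `|y| * `|T x - u|).
  { intros r Hr. pose proof (coordinate_best u f (T y) Hf r) as Hbest.
    pose proof (proj2 (coordinate_dual_ball Hf) (T y)) as HfT. rewrite Tnorm in HfT.
    rewrite <- (isometry_dist T y), <- (isometry_dist T y (r * x)), !Tscal by auto.
    pose proof (norm_le_add (T y - f (T y) * T x) (T y - f (T y) * u)
      ((- f (T y)) * (T x - u)) ltac:(vring)) as Hto.
    pose proof (norm_le_add (T y - r * u) (T y - r * T x)
      (r * (T x - u)) ltac:(vring)) as Hfrom.
    rewrite norm_scal, Rabs_Ropp in Hto. rewrite norm_scal in Hfrom.
    assert (Rabs (f (T y)) * `|T x - u| <= `|y| * `|T x - u|)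
      by (apply Rmult_le_compat_r; [apply norm_nonneg|auto]).
    assert (Rabs r * `|T x - u| <= 2 * `|y| * `|T x - u|)
      by (apply Rmult_le_compat_r; [apply norm_nonneg|auto]).
    lra. }
  destruct (Rle_lt_dec (Rabs t) (2 * `|y|)) as [near|far]; [auto|].
  pose proof (norm_nonneg _ y) as Hy.
  specialize (moderate 0 ltac:(rewrite Rabs_R0; lra)).
  replace (y - 0 * x)%V with y in moderate by vring.
  pose proof (norm_le_sub_far x y t Hx). lra.
Qed.

Lemma transported_coordinate_close u f x y s eta :
  uniformly_convex X -> bicontractive_coordinate u f -> `|x| = 1 -> best_coefficient x y s ->
  0 < eta -> exists d, 0 < d /\ forall T, is_surj_lin_isometry X T -> `|T x - u| < d ->
    Rabs (f (T y) - s) < eta.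
Proof.
  intros Hconvex Hf Hx Hs Heta. pose proof (norm_nonneg _ y) as Hy.
  destruct (almost_best_coefficient_close `|y| eta) as (e & He & Hclose); auto.
  destruct (exists_pos_lt_scaled (3 * `|y|) e) as (d & Hd & Hyd); [lra|auto|].
  exists d. split; auto. intros T HT HTx. apply (Hclose x y); auto; [lra| |]; intros t.
  - pose proof (transported_coordinate_almost_best u f T x y t Hf HT Hx).
    assert (3 * `|y| * `|T x - u| <= 3 * `|y| * d) by (apply Rmult_le_compat_l; lra).
    lra.
  - specialize (Hs t). lra.
Qed.

Lemma transported_coordinate_approx u f x phi (ys : list X) eta :
  uniformly_convex X -> almost_transitive X -> bicontractive_coordinate u f -> `|x| = 1 ->
  (forall y, best_coefficient x y (phi y)) -> 0 < eta ->
  exists T, is_surj_lin_isometry X T /\ Forall (fun y => Rabs (f (T y) - phi y) < eta) ys.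
Proof.
  intros Hconvex Htrans Hf Hx Hphi Heta.
  assert (Hd : exists d, 0 < d /\ forall T, is_surj_lin_isometry X T -> `|T x - u| < d ->
            Forall (fun y => Rabs (f (T y) - phi y) < eta) ys).
  { induction ys as [|y ys (d & Hd & IH)].
    - exists 1. split; [lra|auto].
    - destruct (transported_coordinate_close u f x y (phi y) eta) as (e & He & Hy); auto.
      destruct (exists_pos_le d e) as (d' & Hd' & Hd'd & Hd'e); auto.
      exists d'. split; auto. intros T HT HTx. constructor.
      + apply Hy; [auto|lra].
      + apply IH; [auto|lra]. }
  destruct Hd as (d & Hd & Hall).
  destruct (Htrans x u d) as (T & HT & HTx); auto; [apply (coordinate_unit Hf)|].
  exists T. auto.
Qed.

(* The best coefficients along [x] are limits of the functionals [f o T] with [T x] close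
   to [u], hence linear. *)
Lemma bicontractive_coordinate_everywhere u f x :
  uniformly_convex X -> almost_transitive X -> bicontractive_coordinate u f -> `|x| = 1 ->
  exists phi, bicontractive_coordinate x phi.
Proof.
  intros Hconvex Htrans Hf Hx.
  destruct (functional_choice _ (fun y => best_coefficient_exists x y Hx)) as [phi Hphi].
  assert (approx := fun ys eta => transported_coordinate_approx u f x phi ys eta
                      Hconvex Htrans Hf Hx Hphi).
  pose proof (coordinate_dual_ball Hf) as [(fadd & fscal & _) Hball].
  assert (phi_add : forall y z, phi (y + z)%V = phi y + phi z).
  { intros y z. apply eq_of_abs_sub_lt with 3; [lra|]. intros eta Heta.
    destruct (approx (y :: z :: (y + z)%V :: nil) eta Heta) as (T & HT & Hall).
    rewrite !Forall_cons_iff in Hall. destruct Hall as (Hy & Hz & Hyz & _).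
    rewrite (isometry_add T HT), fadd in Hyz. split_Rabs; lra. }
  assert (phi_scal : forall a y, phi (a * y)%V = a * phi y).
  { intros a y. pose proof (Rabs_pos a) as Ha.
    apply eq_of_abs_sub_lt with (1 + Rabs a); [lra|]. intros eta Heta.
    destruct (approx (y :: (a * y)%V :: nil) eta Heta) as (T & HT & Hall).
    rewrite !Forall_cons_iff in Hall. destruct Hall as (Hy & Hay & _).
    rewrite (isometry_scal T HT), fscal in Hay.
    replace (phi (a * y)%V - a * phi y)
      with (- (a * f (T y) - phi (a * y)%V) + a * (f (T y) - phi y)) by ring.
    eapply Rle_lt_trans; [apply Rabs_triang|]. rewrite Rabs_Ropp, Rabs_mult. nra. }
  exists phi. split; auto.
  - apply dual_ball_of_bound; auto. intros y. apply le_epsilon. intros eta Heta.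
    destruct (approx (y :: nil) eta Heta) as (T & (_ & Tnorm & _) & Hall).
    apply Forall_inv in Hall. specialize (Hball (T y)). rewrite Tnorm in Hball.
    split_Rabs; lra.
  - apply (best_coefficient_unique x x); auto.
    intros t. rewrite (norm_eq_scal _ 0 x), Rabs_R0, Rmult_0_l by vring. apply norm_nonneg.
  - intros y. specialize (Hphi y 0). now replace (y - 0 * x)%V with y in Hphi by vring.
Qed.

End BestCoefficient.

Section DualityForm.
Context {X : Banach}.
Implicit Types (v w x y z e : X) (B : X -> X -> R).

(* [B v w = 0] implies that [v] is Birkhoff orthogonal to [w], so the last field makes the zero
   set of [B] symmetric. *)
Record duality_form B : Prop := {
  form_add_r : forall v w z, B v (w + z)%V = B v w + B v z;
  form_scal_r : forall v a w, B v (a * w)%V = a * B v w;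
  form_self : forall v, B v v = `|v| * `|v|;
  form_bound : forall v w, Rabs (B v w) <= `|v| * `|w|;
  form_orthogonal : forall v w, (forall t, `|v| <= `|v - t * w|) -> B w v = 0 }.

Global Arguments form_add_r {B}.
Global Arguments form_scal_r {B}.
Global Arguments form_self {B}.
Global Arguments form_bound {B}.
Global Arguments form_orthogonal {B}.

Lemma duality_form_exists :
  uniformly_convex X -> (forall x, `|x| = 1 -> exists phi, bicontractive_coordinate x phi) ->
  exists B, duality_form B.
Proof.
  intros Hconvex Hcoord.
  assert (Hdual : forall v, exists phi, v <> zero -> bicontractive_coordinate (/ `|v| * v)%V phi).
  { intros v. destruct (classic (v = zero)) as [->|Hv]; [exists (fun _ => 0); tauto|].
    destruct (Hcoord (/ `|v| * v)%V) as [phi Hphi]; [|eauto].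
    now apply norm_normalize, norm_pos. }
  destruct (functional_choice _ Hdual) as [phi Hphi].
  exists (fun v w => `|v| * phi v w). split.
  - intros v w z. destruct (classic (v = zero)) as [->|Hv]; [rewrite norm_zero; ring|].
    destruct (Hphi v Hv) as [((phi_add & _) & _) _ _ _]. rewrite phi_add. ring.
  - intros v a w. destruct (classic (v = zero)) as [->|Hv]; [rewrite norm_zero; ring|].
    destruct (Hphi v Hv) as [((_ & phi_scal & _) & _) _ _ _]. rewrite phi_scal. ring.
  - intros v. destruct (classic (v = zero)) as [->|Hv]; [rewrite norm_zero; ring|].
    destruct (Hphi v Hv) as [((_ & phi_scal & _) & _) _ phi_self _].
    apply norm_pos in Hv. rewrite (scal_normalize v Hv) at 3. rewrite phi_scal, phi_self. ring.
  - intros v w. destruct (classic (v = zero)) as [->|Hv].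
    + rewrite norm_zero, !Rmult_0_l, Rabs_R0. lra.
    + rewrite Rabs_mult, (Rabs_pos_eq `|v|) by apply norm_nonneg.
      apply Rmult_le_compat_l; [apply norm_nonneg|]. apply (Hphi v Hv).
  - intros v w Hvw. destruct (classic (w = zero)) as [->|Hw]; [rewrite norm_zero; ring|].
    pose proof (Hphi w Hw) as Hbest. pose proof (coordinate_unit Hbest) as Hunit.
    apply coordinate_best with (y := v) in Hbest.
    rewrite (best_coefficient_unique _ v (phi w v) 0 Hconvex Hunit Hbest); [ring|].
    intros t. replace (v - 0 * (/ `|w| * w))%V with v by vring.
    replace (v - t * (/ `|w| * w))%V with (v - (t * / `|w|) * w)%V by vring. apply Hvw.
Qed.

Definition orthonormal B x e : Prop := `|x| = 1 /\ `|e| = 1 /\ B x e = 0.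

(* The direction of [B (x + a * e)] in the plane of [x] and [e]; it is [a] in a Hilbert space. *)
Definition slope B x e (a : R) : R := B (x + a * e)%V e / B (x + a * e)%V x.

Section Orthogonality.
Context {B : X -> X -> R} (HB : duality_form B).

Lemma form_sub_r v w z : B v (w - z)%V = B v w - B v z.
Proof.
  replace (w - z)%V with (w + (-1) * z)%V by vring.
  rewrite (form_add_r HB), (form_scal_r HB). ring.
Qed.

Lemma form_zero_r v : B v zero = 0.
Proof. rewrite <- (scal_zero_l (zero : X)), (form_scal_r HB). ring. Qed.

Lemma form_le v w : B v w <= `|v| * `|w|.
Proof. eapply Rle_trans; [apply Rle_abs|apply (form_bound HB)]. Qed.

Lemma form_zero_orthogonal v w t : B v w = 0 -> `|v| <= `|v - t * w|.
Proof.
  intros H0. pose proof (form_le v (v - t * w)) as H.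
  rewrite form_sub_r, (form_scal_r HB), H0, (form_self HB) in H.
  pose proof (norm_nonneg _ v). pose proof (norm_nonneg _ (v - t * w)%V). nra.
Qed.

Lemma form_zero_sym v w : B v w = 0 -> B w v = 0.
Proof.
  intros H. apply (form_orthogonal HB). intros t. now apply form_zero_orthogonal.
Qed.

Lemma form_zero_l v : B zero v = 0.
Proof. apply form_zero_sym, form_zero_r. Qed.

Lemma form_decompose v w : v <> zero -> exists (a : R) z, w = (a * v + z)%V /\ B v z = 0.
Proof.
  intros Hv. apply norm_pos in Hv.
  exists (B v w / (`|v| * `|v|)), (w - (B v w / (`|v| * `|v|)) * v)%V. split; [vring|].
  rewrite form_sub_r, (form_scal_r HB), (form_self HB). field. lra.
Qed.

(* [B (a * v)] and [B v] have the same kernel, so they are proportional. *)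
Lemma form_scal_l (a : R) v w : B (a * v)%V w = a * B v w.
Proof.
  destruct (classic (v = zero)) as [->|Hv].
  - rewrite scal_zero_r, form_zero_l. ring.
  - destruct (form_decompose v w Hv) as (b & z & -> & Hz).
    assert (Haz : B (a * v)%V z = 0).
    { apply form_zero_sym. rewrite (form_scal_r HB), (form_zero_sym v z Hz). ring. }
    rewrite !(form_add_r HB), !(form_scal_r HB), Hz, Haz.
    destruct (Req_dec a 0) as [->|Ha].
    + rewrite scal_zero_l, form_zero_l. ring.
    + assert (E : a * B (a * v)%V v = a * a * B v v).
      { rewrite <- (form_scal_r HB), !(form_self HB), norm_scal.
        replace (a * a) with (Rabs a * Rabs a) by (rewrite <- Rabs_mult; apply Rabs_pos_eq; nra).
        ring. }
      apply (Rmult_eq_compat_l (/ a)) in E. field_simplify in E; auto. rewrite E. ring.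
Qed.

Lemma form_isometry_zero T v w :
  is_surj_lin_isometry X T -> B v w = 0 -> B (T v) (T w) = 0.
Proof.
  intros HT H0. apply (form_orthogonal HB). intros t.
  rewrite <- (isometry_scal T HT), isometry_dist, (isometry_norm T HT) by auto.
  now apply form_zero_orthogonal, form_zero_sym.
Qed.

(* By symmetry of the zero set, the vectors orthogonal to [B v e * x - B v x * e] form a
   hyperplane; it contains [v] and [z], hence [v + z]. *)
Lemma form_proportional v z x e :
  B z x = 0 -> B z e = 0 -> B (v + z)%V x * B v e = B (v + z)%V e * B v x.
Proof.
  intros Hx He. set (w := (B v e * x - B v x * e)%V).
  assert (Hw : forall z', B z' w = B v e * B z' x - B v x * B z' e)
    by (intros z'; unfold w; now rewrite form_sub_r, !(form_scal_r HB)).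
  assert (Hwv : B w v = 0) by (apply form_zero_sym; rewrite Hw; ring).
  assert (Hwz : B w z = 0) by (apply form_zero_sym; rewrite Hw, Hx, He; ring).
  assert (H : B (v + z)%V w = 0)
    by (apply form_zero_sym; rewrite (form_add_r HB), Hwv, Hwz; ring).
  rewrite Hw in H. lra.
Qed.

Lemma orthonormal_sym x e : orthonormal B x e -> orthonormal B e x.
Proof. intros (Hx & He & H). split; [|split]; auto. now apply form_zero_sym. Qed.

Lemma orthonormal_coord_l x e (a b : R) : orthonormal B x e -> B x (a * x + b * e)%V = a.
Proof.
  intros (Hx & He & H).
  rewrite (form_add_r HB), !(form_scal_r HB), H, (form_self HB), Hx. ring.
Qed.

Lemma orthonormal_coord_r x e (a b : R) : orthonormal B x e -> B e (a * x + b * e)%V = b.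
Proof.
  intros H. rewrite add_comm. now apply orthonormal_coord_l, orthonormal_sym.
Qed.

Lemma orthonormal_translate_l x e (a : R) : orthonormal B x e -> B x (x + a * e)%V = 1.
Proof.
  intros H. replace (x + a * e)%V with (1 * x + a * e)%V by vring. now apply orthonormal_coord_l.
Qed.

Lemma orthonormal_translate_r x e (a : R) : orthonormal B x e -> B e (x + a * e)%V = a.
Proof.
  intros H. replace (x + a * e)%V with (1 * x + a * e)%V by vring. now apply orthonormal_coord_r.
Qed.

Lemma form_translate_pos x e (a : R) : orthonormal B x e -> 0 < B (x + a * e)%V x.
Proof.
  intros H. pose proof H as (Hx & He & _). set (v := (x + a * e)%V).
  assert (Hself : B v x + a * B v e = `|v| * `|v|)
    by (rewrite <- (form_self HB); unfold v at 4; now rewrite (form_add_r HB), (form_scal_r HB)).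
  pose proof (form_bound HB e v) as Ha. pose proof (form_bound HB v e) as Hve.
  unfold v in Ha at 1. rewrite orthonormal_translate_r in Ha by auto.
  rewrite He in Ha, Hve. rewrite Rmult_1_l in Ha. rewrite Rmult_1_r in Hve.
  assert (Hcross : a * B v e <= `|v| * `|v|).
  { eapply Rle_trans; [apply Rle_abs|]. rewrite Rabs_mult.
    apply Rmult_le_compat; auto using Rabs_pos. }
  assert (Hnonzero : B v x <> 0); [|lra].
  intros Hzero. apply form_zero_sym in Hzero. unfold v in Hzero.
  rewrite orthonormal_translate_l in Hzero by auto. lra.
Qed.

Lemma slope_mul_form x e (a : R) :
  orthonormal B x e -> slope B x e a * B (x + a * e)%V x = B (x + a * e)%V e.
Proof.
  intros H. pose proof (form_translate_pos x e a H). unfold slope. field. lra.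
Qed.

Lemma slope_zero x e : orthonormal B x e -> slope B x e 0 = 0.
Proof.
  intros (_ & _ & H). unfold slope. replace (x + 0 * e)%V with x by vring.
  rewrite H. apply Rmult_0_l.
Qed.

Lemma slope_nonzero x e (a : R) : orthonormal B x e -> a <> 0 -> slope B x e a <> 0.
Proof.
  intros H Ha H0. pose proof (slope_mul_form x e a H) as E.
  rewrite H0, Rmult_0_l in E. symmetry in E. apply form_zero_sym in E.
  rewrite orthonormal_translate_r in E; auto.
Qed.

Lemma form_translate x e (a b : R) :
  orthonormal B x e -> B (x + a * e)%V (x + b * e)%V = B (x + a * e)%V x * (1 + b * slope B x e a).
Proof.
  intros H. rewrite (form_add_r HB), (form_scal_r HB), <- (slope_mul_form x e a H). ring.
Qed.

(* [B v w * B w v <= B v v * B w w] for [v = x + a * e] and [w = x + b * e]. *)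
Lemma slope_monotone x e (a b : R) : orthonormal B x e -> a <= b -> slope B x e a <= slope B x e b.
Proof.
  intros H [Hab| ->]; [|lra].
  set (v := (x + a * e)%V). set (w := (x + b * e)%V).
  assert (Hprod : B v w * B w v <= B v v * B w w).
  { rewrite !(form_self HB). eapply Rle_trans; [apply Rle_abs|]. rewrite Rabs_mult.
    replace (`|v| * `|v| * (`|w| * `|w|)) with (`|v| * `|w| * (`|w| * `|v|)) by ring.
    apply Rmult_le_compat; try apply Rabs_pos; apply (form_bound HB). }
  unfold v, w in Hprod. rewrite !form_translate in Hprod by auto.
  pose proof (form_translate_pos x e a H) as Pa. pose proof (form_translate_pos x e b H) as Pb.
  set (p := B (x + a * e)%V x) in *. set (q := B (x + b * e)%V x) in *.
  apply (Rmult_le_reg_l (p * q * (b - a))); [repeat apply Rmult_lt_0_compat; lra|]. lra.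
Qed.

Lemma slope_inverse x e (a : R) :
  orthonormal B x e -> a <> 0 -> slope B x e (- / slope B x e a) = - / a.
Proof.
  intros H Ha. pose proof (slope_nonzero x e a H Ha) as Hs. set (b := - / slope B x e a).
  assert (Hperp : B (x + a * e)%V (x + b * e)%V = 0)
    by (rewrite form_translate by auto; unfold b; field; auto).
  apply form_zero_sym in Hperp. rewrite form_translate in Hperp by auto.
  pose proof (form_translate_pos x e b H).
  apply (Rmult_eq_reg_l a); auto. rewrite <- Ropp_mult_distr_r, Rinv_r by auto.
  apply Rmult_integral in Hperp. destruct Hperp; lra.
Qed.

Lemma slope_add_orthogonal x e z (a l : R) :
  orthonormal B x e -> B z x = 0 -> B z e = 0 -> l <> 0 ->
  slope B x e a * B (l * (x + a * e) + z)%V x = B (l * (x + a * e) + z)%V e.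
Proof.
  intros H Hx He Hl. pose proof (form_translate_pos x e a H) as Hpos.
  pose proof (form_proportional (l * (x + a * e))%V z x e Hx He) as E.
  rewrite !form_scal_l, <- (slope_mul_form x e a H) in E.
  apply (Rmult_eq_reg_r (l * B (x + a * e)%V x)); [lra|].
  apply Rmult_integral_contrapositive_currified; lra.
Qed.

(* All three slopes are ratios of the coordinates of [B (x + b * y + c * e)]. *)
Lemma slope_compose x y e (b c : R) :
  orthonormal B x y -> orthonormal B x e -> orthonormal B y e -> b <> 0 ->
  slope B x e c = slope B y e (c / b) * slope B x y b.
Proof.
  intros Hxy Hxe Hye Hb. set (v := (x + b * y + c * e)%V).
  pose proof Hxy as (Hx & _ & Hxy0). pose proof Hxe as (_ & _ & Hxe0).
  pose proof Hye as (_ & _ & Hye0).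
  assert (Exe : slope B x e c * B v x = B v e).
  { replace v with (1 * (x + c * e) + b * y)%V by (unfold v; vring).
    apply slope_add_orthogonal; auto; try lra; rewrite form_scal_l.
    - rewrite (form_zero_sym x y Hxy0). ring.
    - rewrite Hye0. ring. }
  assert (Exy : slope B x y b * B v x = B v y).
  { replace v with (1 * (x + b * y) + c * e)%V by (unfold v; vring).
    apply slope_add_orthogonal; auto; try lra; rewrite form_scal_l.
    - rewrite (form_zero_sym x e Hxe0). ring.
    - rewrite (form_zero_sym y e Hye0). ring. }
  assert (Eye : slope B y e (c / b) * B v y = B v e).
  { replace v with (b * (y + (c / b) * e) + x)%V by (unfold v; vreduce; field; auto).
    now apply slope_add_orthogonal. }
  assert (Hvx : B v x <> 0).
  { intros H0. apply form_zero_sym in H0. unfold v in H0.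
    rewrite !(form_add_r HB), !(form_scal_r HB), Hxy0, Hxe0, (form_self HB), Hx in H0. lra. }
  apply (Rmult_eq_reg_r (B v x)); auto.
  rewrite Rmult_assoc, Exy, Eye. exact Exe.
Qed.

Lemma slope_multiplicative x y e (a b : R) :
  orthonormal B x y -> orthonormal B x e -> orthonormal B y e -> a <> 0 -> b <> 0 ->
  slope B x y (a * b) * slope B x y 1 = slope B x y a * slope B x y b.
Proof.
  intros Hxy Hxe Hye Ha Hb.
  assert (Hab : a * b <> 0) by now apply Rmult_integral_contrapositive_currified.
  assert (through_one : forall c, slope B x e c = slope B y e c * slope B x y 1).
  { intros c. rewrite (slope_compose x y e 1 c) by (auto; lra).
    now replace (c / 1) with c by field. }
  assert (through_self : forall c, c <> 0 -> slope B x e c = slope B y e 1 * slope B x y c).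
  { intros c Hc. rewrite (slope_compose x y e c c) by auto.
    now replace (c / c) with 1 by (field; auto). }
  assert (through_b : slope B x e (a * b) = slope B y e a * slope B x y b).
  { rewrite (slope_compose x y e b (a * b)) by auto.
    now replace (a * b / b) with a by (field; auto). }
  apply (Rmult_eq_reg_l (slope B y e 1)); [|apply slope_nonzero; auto; lra].
  transitivity (slope B x e (a * b) * slope B x y 1); [rewrite through_self by auto; ring|].
  transitivity (slope B x e a * slope B x y b);
    [rewrite through_b, through_one|rewrite through_self by auto]; ring.
Qed.

End Orthogonality.
End DualityForm.

(** * Pythagoras' identity *)

Section RealFunctions.

Lemma multiplicative_inverse_linear (sigma : R -> R) :
  (forall a b, a <= b -> sigma a <= sigma b) -> sigma 0 = 0 ->
  (forall a, a <> 0 -> sigma a <> 0) ->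
  (forall a b, a <> 0 -> b <> 0 -> sigma (a * b) * sigma 1 = sigma a * sigma b) ->
  (forall a, a <> 0 -> sigma (- / sigma a) = - / a) ->
  0 < sigma 1 /\ forall a, sigma a = sigma 1 * a.
Proof.
  intros mono sigma0 nonzero mult inverse.
  set (c := sigma 1) in *.
  assert (Hc : 0 < c).
  { pose proof (mono 0 1 Rle_0_1) as c_ge0. pose proof (nonzero 1 R1_neq_R0) as c_neq0.
    fold c in c_ge0, c_neq0. lra. }
  split; auto. pose (m := fun a => sigma a / c).
  assert (sigma_m : forall a, sigma a = c * m a) by (intros a; unfold m; field; lra).
  assert (m_mono : forall a b, a <= b -> m a <= m b).
  { intros a b Hab. apply (Rmult_le_reg_l c); auto. rewrite <- !sigma_m. auto. }
  assert (m_nonzero : forall a, a <> 0 -> m a <> 0).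
  { intros a Ha H0. apply (nonzero a Ha). rewrite sigma_m, H0. ring. }
  assert (m_mult : forall a b, a <> 0 -> b <> 0 -> m (a * b) = m a * m b).
  { intros a b Ha Hb. specialize (mult a b Ha Hb). rewrite !sigma_m in mult.
    apply (Rmult_eq_reg_l (c * c)); [lra|nra]. }
  assert (m_one : m 1 = 1) by (unfold m; fold c; field; lra).
  assert (twisted : forall a, a <> 0 -> m c * m (m a) = - (c * m (-1)) * a).
  { intros a Ha. pose proof (m_nonzero a Ha) as Hma.
    assert (Hsa : c * m a <> 0) by (apply Rmult_integral_contrapositive_currified; lra).
    specialize (inverse a Ha). rewrite (sigma_m (- / _)), (sigma_m a) in inverse.
    rewrite <- m_mult by lra.
    replace (-1) with (- / (c * m a) * (c * m a)) by (field; lra).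
    rewrite (m_mult (- / (c * m a))) by (auto using Ropp_neq_0_compat, Rinv_neq_0_compat).
    apply (f_equal (fun r => r * (a * m (c * m a)))) in inverse.
    field_simplify in inverse; auto. lra. }
  assert (m_involutive : forall a, a <> 0 -> m (m a) = a).
  { intros a Ha. pose proof (twisted 1 R1_neq_R0) as twisted_one. rewrite !m_one in twisted_one.
    pose proof (m_nonzero c ltac:(lra)) as Hmc.
    apply (Rmult_eq_reg_l (m c)); auto. rewrite twisted by auto. nra. }
  intros a. destruct (Req_dec a 0) as [->|Ha]; [rewrite sigma0; ring|].
  rewrite sigma_m. f_equal. pose proof (m_involutive a Ha) as Hinv.
  destruct (Rle_lt_dec (m a) a) as [below|above].
  - pose proof (m_mono _ _ below). lra.
  - pose proof (m_mono a (m a)). lra.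
Qed.

Lemma quadratic_lower_bound_constant (D : R -> R) (K : R) :
  0 <= K -> (forall t, 0 <= D t) -> (forall s t, D s * (1 - K * (s - t) ^ 2) <= D t) ->
  constant D.
Proof.
  intros HK Hpos Hlow.
  assert (Hderiv : forall s, derivable_pt_lim D s 0).
  { intros s e He. pose proof (Hpos s) as Hs.
    destruct (exists_pos_lt_scaled (2 * K * D s) e) as (d1 & Hd1 & HKd1); [nra|auto|].
    destruct (exists_pos_lt_scaled K (1 / 2)) as (d2 & Hd2 & HKd2); [auto|lra|].
    destruct (exists_pos_le 1 d2) as (d3 & Hd3 & Hd3_one & Hd32); [lra|auto|].
    destruct (exists_pos_le d1 d3) as (d & Hd & Hdd1 & Hdd3); auto.
    exists (mkposreal d Hd). simpl. intros k Hk Hkd. pose proof (Rabs_pos_lt k Hk) as Hk0.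
    assert (Hk2 : k ^ 2 = Rabs k * Rabs k) by (rewrite <- Rabs_mult, Rabs_pos_eq; nra).
    pose proof (Hlow s (s + k)) as Hto. pose proof (Hlow (s + k) s) as Hfrom.
    replace ((s - (s + k)) ^ 2) with (k ^ 2) in Hto by ring.
    replace ((s + k - s) ^ 2) with (k ^ 2) in Hfrom by ring.
    pose proof (Hpos (s + k)) as Hsk.
    assert (HKk : 0 <= K * k ^ 2 <= 1 / 2) by (rewrite Hk2; split; nra).
    assert (Hdouble : D (s + k) <= 2 * D s) by nra.
    assert (Hdiff : Rabs (D (s + k) - D s) <= 2 * K * D s * (Rabs k * Rabs k))
      by (rewrite <- Hk2; apply Rabs_le; nra).
    rewrite Rminus_0_r. unfold Rdiv. rewrite Rabs_mult, Rabs_inv.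
    apply (Rmult_lt_reg_r (Rabs k)); auto. rewrite Rmult_assoc, Rinv_l by lra.
    assert (2 * K * D s * Rabs k <= 2 * K * D s * d1)
      by (apply Rmult_le_compat_l; [nra|lra]).
    nra. }
  apply (null_derivative_1 D (fun s => exist _ 0 (Hderiv s))). reflexivity.
Qed.

Lemma quadratic_ratio_lower_bound (a b c s t : R) :
  0 <= c -> 0 < a -> 0 < b -> a * (1 + c * s * t) <= b * (1 + c * s * s) ->
  a * a / (1 + c * s * s) * (1 - c * (s - t) ^ 2) <= b * b / (1 + c * t * t).
Proof.
  intros Hc Ha Hb Hab.
  assert (Hq : forall r, 1 <= 1 + c * r * r) by (intros r; assert (0 <= c * (r * r)) by nra; lra).
  pose proof (Hq s) as Qs. pose proof (Hq t) as Qt.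
  set (k := c * (s - t) ^ 2).
  assert (Hk : 0 <= k) by (apply Rmult_le_pos; [auto|apply pow2_ge_0]).
  assert (identity : (1 + c * s * t) * (1 + c * s * t) =
            (1 + c * s * s) * (1 + c * t * t) - k) by (unfold k; ring).
  set (A := a * a / (1 + c * s * s)). set (D := b * b / (1 + c * t * t)).
  assert (EA : a * a = A * (1 + c * s * s)) by (unfold A; field; lra).
  assert (ED : b * b = D * (1 + c * t * t)) by (unfold D; field; lra).
  assert (HA : 0 <= A) by nra. assert (HD : 0 <= D) by nra.
  destruct (Rle_lt_dec (1 + c * s * t) 0) as [neg|pos].
  - assert (1 <= k) by (unfold k; nra). nra.
  - assert (squared : a * a * ((1 + c * s * t) * (1 + c * s * t)) <=
              b * b * ((1 + c * s * s) * (1 + c * s * s))).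
    { assert (Hpos : 0 <= a * (1 + c * s * t)) by (apply Rmult_le_pos; lra).
      pose proof (Rmult_le_compat _ _ _ _ Hpos Hpos Hab Hab). lra. }
    rewrite identity, EA, ED in squared.
    set (Ss := 1 + c * s * s) in *. set (St := 1 + c * t * t) in *.
    assert (reduced : A * (Ss * St - k) <= D * (Ss * St))
      by (apply (Rmult_le_reg_l Ss); lra).
    assert (HS : 1 <= Ss * St) by nra.
    assert (0 <= A * k * (Ss * St - 1)) by (apply Rmult_le_pos; nra).
    apply (Rmult_le_reg_r (Ss * St)); lra.
Qed.

Lemma norm_profile_quadratic (N : R -> R) (c : R) :
  0 <= c -> (forall t, 0 < N t) ->
  (forall s t, N s * (1 + c * s * t) <= N t * (1 + c * s * s)) ->
  forall t, N t * N t = N 0 * N 0 * (1 + c * t * t).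
Proof.
  intros Hc Hpos Hsupport t.
  assert (Hq : forall s, 0 < 1 + c * s * s) by (intros s; assert (0 <= c * (s * s)) by nra; lra).
  pose (D := fun s => N s * N s / (1 + c * s * s)).
  assert (HN : forall s, N s * N s = D s * (1 + c * s * s))
    by (intros s; unfold D; field; specialize (Hq s); lra).
  assert (HD : D t = D 0).
  { apply (quadratic_lower_bound_constant D c); auto.
    - intros s. specialize (Hpos s). apply Rlt_le, Rdiv_lt_0_compat; [nra|auto].
    - intros s r. now apply quadratic_ratio_lower_bound. }
  rewrite HN, HD, (HN 0). ring.
Qed.

End RealFunctions.

Section ThirdVector.
Context {X : Banach} {B : X -> X -> R} (HB : duality_form B).
Implicit Types v w x y e : X.

Definition pythagorean x e : Prop := forall t, `|x + t * e| * `|x + t * e| = 1 + t * t.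

Lemma third_vector_quadratic x y e :
  orthonormal B x y -> orthonormal B x e -> orthonormal B y e ->
  exists c, forall t, `|x + t * y| * `|x + t * y| = 1 + c * t * t.
Proof.
  intros Hxy Hxe Hye.
  destruct (multiplicative_inverse_linear (slope B x y)) as [Hc Hlin].
  - intros a b. now apply slope_monotone.
  - now apply slope_zero.
  - intros a. now apply slope_nonzero.
  - intros a b. now apply (slope_multiplicative HB x y e).
  - intros a. now apply slope_inverse.
  - set (c := slope B x y 1) in *. exists c. pose proof Hxy as (Hx & _).
    set (N := fun t => `|x + t * y|).
    assert (N0 : N 0 = 1) by (unfold N; rewrite <- Hx; f_equal; vring).
    assert (HN : forall t, 0 < N t).
    { intros t. pose proof (form_le HB x (x + t * y)) as H.
      rewrite (orthonormal_translate_l HB x y t Hxy), Hx in H. unfold N. lra. }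
    intros t. change (N t * N t = 1 + c * t * t).
    rewrite (norm_profile_quadratic N c), N0; [ring|lra|auto|].
    clear t. intros s t.
    pose proof (form_translate_pos HB x y s Hxy) as Hpos.
    pose proof (form_le HB (x + s * y) (x + t * y)) as Hst.
    pose proof (form_self HB (x + s * y)%V) as Hss.
    rewrite form_translate, Hlin in Hst, Hss by auto. fold (N s) (N t) in Hst, Hss.
    pose proof (HN s) as Ns. set (p := B (x + s * y)%V x) in *.
    assert (0 <= c * (s * s)) by nra.
    apply (Rmult_le_reg_l (N s * p)); [nra|].
    replace (N s * p * (N t * (1 + c * s * s))) with (N s * N t * (p * (1 + s * (c * s)))) by ring.
    rewrite Hss. nra.
Qed.

Lemma pythagorean_of_third x y e :
  orthonormal B x y -> orthonormal B x e -> orthonormal B y e -> pythagorean x y.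
Proof.
  intros Hxy Hxe Hye.
  destruct (third_vector_quadratic x y e) as [c Hc]; auto.
  destruct (third_vector_quadratic y x e) as [c' Hc']; auto.
  { now apply orthonormal_sym. }
  assert (exchange : forall t, 0 < t -> 1 + c * t * t = t * t + c').
  { intros t Ht. rewrite <- Hc.
    replace (x + t * y)%V with (t * (y + / t * x))%V by (vreduce; field; lra).
    rewrite norm_scal_nonneg by lra.
    transitivity (t * t * (`|y + / t * x| * `|y + / t * x|)); [ring|].
    rewrite Hc'. field. lra. }
  pose proof (exchange 1 Rlt_0_1). pose proof (exchange 2 Rlt_0_2).
  assert (c = 1) as -> by lra. intros t. rewrite Hc. ring.
Qed.

End ThirdVector.

Section Plane.
Context {X : Banach} {B : X -> X -> R} (HB : duality_form B).
Hypothesis X_convex : uniformly_convex X.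
Hypothesis X_transitive : almost_transitive X.
Implicit Types v w x y e p q : X.

Definition spanning x e : Prop := forall v, v = (B x v * x + B e v * e)%V.

Lemma spanning_of_generators p q :
  orthonormal B p q -> (forall v, exists a b : R, v = (a * p + b * q)%V) -> spanning p q.
Proof.
  intros Hpq Hgen v. destruct (Hgen v) as (a & b & ->).
  now rewrite (orthonormal_coord_l HB), (orthonormal_coord_r HB).
Qed.

Lemma third_vector_or_spanning x y :
  orthonormal B x y -> (exists e, orthonormal B x e /\ orthonormal B y e) \/ spanning x y.
Proof.
  intros Hxy. destruct (classic (spanning x y)) as [|Hspan]; auto. left.
  apply not_all_ex_not in Hspan. destruct Hspan as [v Hv].
  set (w := (v - (B x v * x + B y v * y))%V).
  assert (Hw : 0 < `|w|).
  { apply norm_pos. intros H0. apply Hv, eq_of_norm_sub. fold w. rewrite H0. apply norm_zero. }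
  pose proof Hxy as (Hx & Hy & _). exists (/ `|w| * w)%V.
  pose proof (norm_normalize w Hw).
  split; split; auto; split; auto; rewrite (form_scal_r HB); unfold w at 2;
    rewrite (form_sub_r HB).
  - rewrite (orthonormal_coord_l HB) by auto. ring.
  - rewrite (orthonormal_coord_r HB) by auto. ring.
Qed.

Lemma close_of_form_almost_one eta :
  0 < eta -> exists d, 0 < d /\
    forall x v, `|x| = 1 -> `|v| = 1 -> 1 - d <= B x v -> `|v - x| < eta.
Proof.
  intros Heta. destruct (X_convex eta Heta) as (d & Hd & Hmod).
  exists d. split; auto. intros x v Hx Hv Hxv.
  rewrite <- (Rplus_0_l eta). apply Hmod. split; [lra|split; [lra|]].
  pose proof (form_le HB x (v + x)) as H.
  rewrite (form_add_r HB), (form_self HB), Hx in H. lra.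
Qed.

(* [B (T e) (T x) = 0], so [B (T e) e] is small, and the [x]-coordinate of [T e] is close
   to 1 or -1. *)
Lemma isometry_almost_exchange x e eta :
  orthonormal B x e -> spanning x e -> 0 < eta ->
  exists T, is_surj_lin_isometry X T /\ `|T x - e| < eta /\
    (`|T e - x| < eta \/ `|T e - opp x| < eta).
Proof.
  intros Hxe Hspan Heta. pose proof Hxe as (Hx & He & _).
  destruct (close_of_form_almost_one eta Heta) as (d0 & Hd0 & Hclose).
  destruct (exists_pos_le eta d0) as (d & Hd & Hd_eta & Hdd0); auto.
  destruct (X_transitive x e d) as (T & HT & HTx); auto.
  exists T. split; [auto|split; [lra|]]. pose proof HT as (_ & Tnorm & _).
  pose proof (form_isometry_zero HB T e x HT (form_zero_sym HB _ _ (proj2 (proj2 Hxe)))) as Hperp.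
  set (v := T e) in *. assert (Hv : `|v| = 1) by (unfold v; rewrite Tnorm; auto).
  pose proof (form_self HB v) as Hself. rewrite (Hspan v) in Hself at 2.
  rewrite (form_add_r HB), !(form_scal_r HB), Hv in Hself.
  assert (Hve : Rabs (B v e) < d).
  { replace (B v e) with (B v (e - T x)%V) by (rewrite (form_sub_r HB), Hperp; ring).
    eapply Rle_lt_trans; [apply (form_bound HB)|]. rewrite Hv, norm_sub_comm. lra. }
  pose proof (form_bound HB v x) as Hvx. rewrite Hv, Hx in Hvx.
  pose proof (form_bound HB e v) as Hev. rewrite Hv, He in Hev.
  assert (Hlarge : 1 - d <= Rabs (B x v)).
  { pose proof (Rabs_triang (B x v * B v x) (B e v * B v e)) as H.
    rewrite Hself, !Rabs_mult, Rabs_R1 in H.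
    pose proof (Rabs_pos (B x v)). pose proof (Rabs_pos (B v e)). nra. }
  destruct (Rle_lt_dec 0 (B x v)) as [pos|neg]; [left|right]; apply Hclose; auto.
  - rewrite Rabs_pos_eq in Hlarge by auto. lra.
  - now rewrite norm_opp.
  - rewrite opp_scal, (form_scal_l HB). rewrite Rabs_left in Hlarge by auto. lra.
Qed.

Definition isometric_pairs x e x' e' : Prop :=
  forall a b : R, `|a * x' + b * e'| = `|a * x + b * e|.

Lemma isometric_pairs_of_approx x e x' e' :
  (forall eta, 0 < eta ->
     exists T, is_surj_lin_isometry X T /\ `|T x - x'| < eta /\ `|T e - e'| < eta) ->
  isometric_pairs x e x' e'.
Proof.
  intros Happrox a b. pose proof (Rabs_pos a) as Ha. pose proof (Rabs_pos b) as Hb.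
  apply eq_of_abs_sub_lt with (Rabs a + Rabs b + 1); [lra|]. intros eta Heta.
  destruct (Happrox eta Heta) as (T & ((Tadd & Tscal) & Tnorm & _) & HTx & HTe).
  rewrite <- (Tnorm (a * x + b * e)%V), Tadd, !Tscal.
  set (v := (a * T x + b * T e)%V). set (v' := (a * x' + b * e')%V).
  assert (Hd : `|v - v'| <= Rabs a * `|T x - x'| + Rabs b * `|T e - e'|).
  { rewrite <- !norm_scal. apply norm_le_add. unfold v, v'. vring. }
  pose proof (norm_le_sub_add v v') as Hvv'. pose proof (norm_le_sub_add v' v) as Hv'v.
  rewrite (norm_sub_comm v' v) in Hv'v.
  assert (Rabs a * `|T x - x'| <= Rabs a * eta) by (apply Rmult_le_compat_l; lra).
  assert (Rabs b * `|T e - e'| <= Rabs b * eta) by (apply Rmult_le_compat_l; lra).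
  apply Rabs_def1; lra.
Qed.

Lemma swap_or_turn x e :
  orthonormal B x e -> spanning x e ->
  isometric_pairs x e e x \/ isometric_pairs x e e (opp x).
Proof.
  intros Hxe Hspan.
  destruct (classic (forall eta, 0 < eta ->
    exists T, is_surj_lin_isometry X T /\ `|T x - e| < eta /\ `|T e - x| < eta))
    as [Hswap|Hno_swap]; [left|right]; apply isometric_pairs_of_approx; auto.
  intros eta Heta. apply not_all_ex_not in Hno_swap. destruct Hno_swap as [eta0 Hno_swap].
  apply imply_to_and in Hno_swap. destruct Hno_swap as [Heta0 Hno_swap].
  destruct (exists_pos_le eta eta0) as (d & Hd & Hd_eta & Hd_eta0); auto.
  destruct (isometry_almost_exchange x e d Hxe Hspan Hd) as (T & HT & HTx & [HTe|HTe]).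
  - exfalso. apply Hno_swap. exists T. split; [auto|lra].
  - exists T. split; [auto|lra].
Qed.

Lemma reflection_orthonormal p q :
  `|p| = 1 -> `|q| = 1 -> isometric_pairs p q p (opp q) -> orthonormal B p q.
Proof.
  intros Hp Hq Hrefl. split; [|split]; auto. apply (form_orthogonal HB). intros t.
  pose proof (Hrefl t (-1)) as E.
  replace (t * p + (-1) * opp q)%V with (t * p + q)%V in E by vring.
  replace (t * p + (-1) * q)%V with (opp (q - t * p)) in E by vring.
  rewrite norm_opp in E.
  pose proof (norm_le_add (2 * q) (q - t * p) (t * p + q) ltac:(vring)) as H.
  rewrite norm_scal_nonneg in H by lra. lra.
Qed.

Lemma swap_diagonals x e :
  orthonormal B x e -> spanning x e -> isometric_pairs x e e x ->
  exists p q, orthonormal B p q /\ spanning p q /\ isometric_pairs p q p (opp q).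
Proof.
  intros Hxe Hspan Hswap.
  assert (Hnonzero : forall a : R, a <> 0 -> 0 < `|e + a * x|).
  { intros a Ha. apply norm_pos. intros E. apply Ha.
    rewrite <- (orthonormal_translate_r HB e x a (orthonormal_sym HB _ _ Hxe)), E.
    apply (form_zero_r HB). }
  pose proof (Hnonzero 1 R1_neq_R0) as Hn. pose proof (Hnonzero (-1) ltac:(lra)) as Hn'.
  set (n := `|e + 1 * x|) in *. set (n' := `|e + (-1) * x|) in *.
  set (p := (/ n * (e + 1 * x))%V). set (q := (/ n' * (e + (-1) * x))%V).
  assert (Hrefl : isometric_pairs p q p (opp q)).
  { intros a b.
    replace (a * p + b * opp q)%V
      with ((a * / n - b * / n') * e + (a * / n + b * / n') * x)%V by (unfold p, q; vring).
    rewrite Hswap. f_equal. unfold p, q. vring. }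
  assert (Hpq : orthonormal B p q)
    by (apply reflection_orthonormal; auto; now apply norm_normalize).
  exists p, q. split; [auto|split; [|auto]].
  apply spanning_of_generators; auto. intros v.
  exists (n * (B e v + B x v) / 2), (n' * (B e v - B x v) / 2).
  rewrite (Hspan v) at 1. unfold p, q. vreduce; field; lra.
Qed.

Lemma turn_basis_exists x e :
  orthonormal B x e -> spanning x e ->
  exists p q, orthonormal B p q /\ spanning p q /\ isometric_pairs p q q (opp p).
Proof.
  intros Hxe Hspan. destruct (swap_or_turn x e Hxe Hspan) as [Hswap|Hturn];
    [|now exists x, e].
  destruct (swap_diagonals x e Hxe Hspan Hswap) as (p & q & Hpq & Hspan_pq & Hrefl).
  exists p, q. split; [auto|split; [auto|]].
  destruct (swap_or_turn p q Hpq Hspan_pq) as [Hswap_pq|]; auto.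
  intros a b. rewrite <- Hrefl.
  replace (a * q + b * opp p)%V with (a * q + (- b) * p)%V by vring.
  rewrite Hswap_pq. f_equal. vring.
Qed.

Section Area.
Context {x e : X} (Hxe : orthonormal B x e) (Hspan : spanning x e).

Definition area p q : R := B x p * B e q - B e p * B x q.

Lemma area_self : area x e = 1.
Proof.
  destruct Hxe as (Hx & He & H0). unfold area. rewrite H0, !(form_self HB), Hx, He. ring.
Qed.

Lemma area_bound p q : Rabs (area p q) <= 2 * (`|p| * `|q|).
Proof.
  destruct Hxe as (Hx & He & _).
  assert (Hprod : forall z w, `|z| = 1 -> `|w| = 1 ->
            Rabs (B z p) * Rabs (B w q) <= `|p| * `|q|).
  { intros z w Hz Hw. pose proof (form_bound HB z p) as Bz. pose proof (form_bound HB w q) as Bw.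
    rewrite Hz, Rmult_1_l in Bz. rewrite Hw, Rmult_1_l in Bw.
    apply Rmult_le_compat; auto using Rabs_pos. }
  pose proof (Hprod x e Hx He). pose proof (Hprod e x He Hx).
  unfold area, Rminus. eapply Rle_trans; [apply Rabs_triang|].
  rewrite Rabs_Ropp, !Rabs_mult. lra.
Qed.

Lemma area_sub_l p p' q : area (p - p')%V q = area p q - area p' q.
Proof. unfold area. rewrite !(form_sub_r HB). ring. Qed.

Lemma area_isometry T p q :
  is_surj_lin_isometry X T -> area (T p) (T q) = area (T x) (T e) * area p q.
Proof.
  intros ((Tadd & Tscal) & _). unfold area.
  rewrite (Hspan p) at 1 2. rewrite (Hspan q) at 1 2.
  rewrite !Tadd, !Tscal, !(form_add_r HB), !(form_scal_r HB). ring.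
Qed.

(* Otherwise [T] would increase the supremum of the area of pairs of unit vectors. *)
Lemma isometry_area_le_one T :
  is_surj_lin_isometry X T -> Rabs (area (T x) (T e)) <= 1.
Proof.
  intros HT. pose proof HT as (_ & Tnorm & _). pose proof Hxe as (Hx & He & _).
  destruct (completeness (fun r => exists p q, `|p| = 1 /\ `|q| = 1 /\ r = Rabs (area p q)))
    as [sup [sup_upper sup_least]].
  - exists 2. intros r (p & q & Hp & Hq & ->). pose proof (area_bound p q) as H.
    rewrite Hp, Hq in H. lra.
  - exists (Rabs (area x e)), x, e. auto.
  - assert (Hsup : 1 <= sup).
    { apply sup_upper. exists x, e. now rewrite area_self, Rabs_R1. }
    apply Rnot_lt_le. intros Hlarge. set (r := Rabs (area (T x) (T e))) in *.
    assert (Hle : sup <= / r * sup).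
    { apply sup_least. intros s (p & q & Hp & Hq & ->).
      apply (Rmult_le_reg_l r); [lra|]. rewrite <- Rmult_assoc, Rinv_r, Rmult_1_l by lra.
      unfold r. rewrite <- Rabs_mult, <- area_isometry by auto.
      apply sup_upper. exists (T p), (T q). rewrite !Tnorm. auto. }
    apply (Rmult_le_compat_l r) in Hle; [|lra].
    rewrite <- Rmult_assoc, Rinv_r, Rmult_1_l in Hle by lra. nra.
Qed.

Lemma area_le_one v w : `|v| = 1 -> `|w| = 1 -> Rabs (area v w) <= 1.
Proof.
  intros Hv Hw. apply le_epsilon. intros eps Heps. pose proof Hxe as (Hx & He & H0).
  destruct (X_transitive x v (eps / 2) Hx Hv) as (T & HT & HTx); [lra|].
  pose proof HT as (_ & Tnorm & Tsurj). destruct (Tsurj w) as [w' <-]. rewrite Tnorm in Hw.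
  replace (area v (T w')) with (area (T x) (T w') + area (v - T x)%V (T w'))
    by (rewrite area_sub_l; ring).
  eapply Rle_trans; [apply Rabs_triang|].
  pose proof (area_bound (v - T x) (T w')) as Hsmall.
  rewrite norm_sub_comm, Tnorm, Hw in Hsmall.
  assert (Hmain : Rabs (area (T x) (T w')) <= 1); [|lra].
  rewrite area_isometry, Rabs_mult by auto.
  assert (Hxw : Rabs (area x w') <= 1).
  { unfold area. rewrite (form_self HB), (form_zero_sym HB _ _ H0), Hx.
    replace (1 * 1 * B e w' - 0 * B x w') with (B e w') by ring.
    eapply Rle_trans; [apply (form_bound HB)|]. rewrite He, Hw. lra. }
  rewrite <- (Rmult_1_r 1).
  apply Rmult_le_compat; auto using Rabs_pos, isometry_area_le_one.
Qed.

Lemma area_almost_one v eps :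
  `|v| = 1 -> 0 < eps -> exists w, `|w| = 1 /\ 1 - eps <= Rabs (area v w).
Proof.
  intros Hv Heps. pose proof Hxe as (Hx & He & H0).
  destruct (X_transitive v x eps Hv Hx Heps) as (T & HT & HTv).
  pose proof HT as (_ & Tnorm & Tsurj). destruct (Tsurj e) as [w Hw].
  exists w. split; [rewrite <- Tnorm, Hw; auto|].
  apply Rle_trans with (Rabs (area (T v) (T w))).
  - rewrite Hw. unfold area. rewrite H0, (form_self HB), He.
    pose proof (form_bound HB x (T v - x)) as Hclose.
    rewrite (form_sub_r HB), (form_self HB), Hx in Hclose. split_Rabs; lra.
  - rewrite area_isometry, Rabs_mult by auto.
    rewrite <- (Rmult_1_l (Rabs (area v w))) at 2.
    apply Rmult_le_compat_r; [apply Rabs_pos|now apply isometry_area_le_one].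
Qed.

Hypothesis Hturn : isometric_pairs x e e (opp x).

Let sum_squares v : R := B x v * B x v + B e v * B e v.

(* The quarter turn of [v] is a unit vector spanning with [v] the area [sum_squares v]. *)
Lemma turn_sum_squares_le v : `|v| = 1 -> sum_squares v <= 1.
Proof.
  intros Hv. set (w := (B x v * e + B e v * opp x)%V).
  assert (Hw : `|w| = 1) by (unfold w; rewrite (Hturn (B x v) (B e v)), <- (Hspan v); exact Hv).
  eapply Rle_trans; [|apply (area_le_one v w Hv Hw)].
  eapply Rle_trans; [|apply Rle_abs].
  pose proof Hxe as (Hx & He & H0). unfold sum_squares, area, w.
  rewrite opp_scal, !(form_add_r HB), !(form_scal_r HB), !(form_self HB), Hx, He, H0,
    (form_zero_sym HB _ _ H0).
  lra.
Qed.

Lemma area_sqr_le v w : area v w * area v w <= sum_squares v * sum_squares w.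
Proof.
  unfold area, sum_squares.
  pose proof (Rle_0_sqr (B x v * B x w + B e v * B e w)) as H. unfold Rsqr in H. lra.
Qed.

Lemma turn_sum_squares_ge v : `|v| = 1 -> 1 <= sum_squares v.
Proof.
  intros Hv. apply le_epsilon. intros eps Heps.
  destruct (exists_pos_le 1 (eps / 2)) as (d & Hd & Hd_one & Hd_eps); [lra|lra|].
  destruct (area_almost_one v d Hv Hd) as (w & Hw & Harea).
  pose proof (turn_sum_squares_le w Hw). pose proof (area_sqr_le v w) as Hsqr.
  assert (0 <= sum_squares v) by (unfold sum_squares; nra).
  assert (Habs : (1 - d) * (1 - d) <= area v w * area v w).
  { rewrite <- (Rabs_pos_eq (area v w * area v w)), Rabs_mult by nra.
    apply Rmult_le_compat; lra. }
  nra.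
Qed.

Lemma turn_norm_sqr v : `|v| * `|v| = sum_squares v.
Proof.
  destruct (classic (v = zero)) as [->|Hv].
  - unfold sum_squares. rewrite !(form_zero_r HB), norm_zero. ring.
  - apply norm_pos in Hv. pose proof (norm_normalize v Hv) as Hunit.
    pose proof (turn_sum_squares_le _ Hunit). pose proof (turn_sum_squares_ge _ Hunit).
    assert (Hone : sum_squares (/ `|v| * v)%V = 1) by lra.
    rewrite (scal_normalize v Hv) at 3. unfold sum_squares in *.
    rewrite !(form_scal_r HB _ `|v|).
    transitivity (`|v| * `|v| * 1); [ring|]. rewrite <- Hone. ring.
Qed.

End Area.

Lemma euclidean_plane_pythagorean p q x e :
  (forall v, `|v| * `|v| = B p v * B p v + B q v * B q v) -> orthonormal B x e ->
  pythagorean x e.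
Proof.
  intros Heuclid (Hx & He & Hxe).
  set (d := B p x * B p e + B q x * B q e).
  assert (expand : forall t, `|x + t * e| * `|x + t * e| = 1 + 2 * t * d + t * t).
  { intros t. pose proof (Heuclid x) as Nx. pose proof (Heuclid e) as Ne.
    rewrite Hx in Nx. rewrite He in Ne.
    rewrite Heuclid, !(form_add_r HB), !(form_scal_r HB).
    transitivity ((B p x * B p x + B q x * B q x) + 2 * t * d +
      t * t * (B p e * B p e + B q e * B q e)); [unfold d; ring|].
    rewrite <- Nx, <- Ne. ring. }
  assert (Hd : d = 0).
  { pose proof (form_zero_orthogonal HB x e d Hxe) as H.
    replace (x - d * e)%V with (x + (- d) * e)%V in H by vring.
    specialize (expand (- d)). rewrite Hx in H. nra. }
  intros t. rewrite expand, Hd. ring.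
Qed.

Lemma orthonormal_pythagorean x e : orthonormal B x e -> pythagorean x e.
Proof.
  intros Hxe. destruct (third_vector_or_spanning x e Hxe) as [(z & Hxz & Hez)|Hspan].
  - now apply (pythagorean_of_third HB x e z).
  - destruct (turn_basis_exists x e Hxe Hspan) as (p & q & Hpq & Hspan_pq & Hturn).
    apply (euclidean_plane_pythagorean p q); auto. now apply turn_norm_sqr.
Qed.

Lemma form_pythagoras v w : B v w = 0 -> `|v + w| * `|v + w| = `|v| * `|v| + `|w| * `|w|.
Proof.
  intros H0.
  destruct (classic (v = zero)) as [->|Hv]; [rewrite add_zero_l, norm_zero; ring|].
  destruct (classic (w = zero)) as [->|Hw]; [rewrite add_zero, norm_zero; ring|].
  apply norm_pos in Hv, Hw.
  assert (Hort : orthonormal B (/ `|v| * v)%V (/ `|w| * w)%V).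
  { split; [|split]; try now apply norm_normalize.
    rewrite (form_scal_r HB), (form_scal_l HB), H0. ring. }
  pose proof (orthonormal_pythagorean _ _ Hort (`|w| / `|v|)) as E.
  replace (v + w)%V with (`|v| * (/ `|v| * v + (`|w| / `|v|) * (/ `|w| * w)))%V
    by (vreduce; field; lra).
  rewrite norm_scal_nonneg by lra.
  transitivity (`|v| * `|v| * (1 + `|w| / `|v| * (`|w| / `|v|))); [rewrite <- E; ring|].
  field. lra.
Qed.

Lemma norm_add_sqr v w : `|v + w| * `|v + w| = `|v| * `|v| + 2 * B v w + `|w| * `|w|.
Proof.
  destruct (classic (v = zero)) as [->|Hv].
  - rewrite (form_zero_l HB), add_zero_l, norm_zero. ring.
  - destruct (form_decompose HB v w Hv) as (a & z & -> & Hz).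
    assert (Haz : forall b : R, B (b * v)%V z = 0)
      by (intros b; rewrite (form_scal_l HB), Hz; ring).
    replace (v + (a * v + z))%V with ((1 + a) * v + z)%V by vring.
    rewrite !form_pythagoras by auto.
    rewrite <- !(form_self HB v), <- !(form_self HB (_ * v)%V).
    rewrite (form_add_r HB), !(form_scal_r HB), !(form_scal_l HB), Hz. ring.
Qed.

Lemma form_sym v w : B v w = B w v.
Proof.
  pose proof (norm_add_sqr v w) as Hvw. pose proof (norm_add_sqr w v) as Hwv.
  rewrite add_comm in Hvw. lra.
Qed.

End Plane.

Lemma duality_form_hilbert {X : Banach} (B : X -> X -> R) :
  duality_form B -> (forall v w, B v w = B w v) -> is_hilbert X.
Proof.
  intros HB Bsym. exists B. split; [auto|split; [|split; [|split]]].
  - intros x y z. rewrite !(Bsym _ z). apply (form_add_r HB).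
  - intros a x y. apply (form_scal_l HB).
  - intros x. rewrite (form_self HB). apply Rmult_le_pos; apply norm_nonneg.
  - intros x. rewrite (form_self HB), sqrt_square; auto. apply norm_nonneg.
Qed.

Theorem theorem5p1 (X : Banach) (u : X) (P : X -> X) :
  convex_transitive X ->
  sphere_X X u ->
  (* P : X -> [u] is a linear projection *)
  is_linear X P ->
  (forall x, P (P x) = P x) ->
  (forall y, (exists x, P x = y) <-> (exists a, y = scal a u)) ->
  (* P bicontractive *)
  (forall x, norm (P x) <= norm x) ->
  (forall x, norm (sub X x (P x)) <= norm x) ->
  (* (i) weakly exposed points of B_X are norm-dense in S_X *)
  (forall y, sphere_X X y -> forall eps, 0 < eps ->
     exists x, weakly_exposed X x /\ norm (sub X x y) < eps) ->
  (* (ii) u o J is upper semi-continuous at u on (S_X, w) *)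
  usc_weak_at X (uJ X u) u ->
  is_hilbert X.
Proof.
  intros Htrans Hu Plin Pidem Prange Pnorm Pres Hdense Husc.
  destruct (bicontractive_projection_coordinate u P) as [f Hf]; auto.
  assert (Hconvex : uniformly_convex X) by now apply (uniformly_convex_of_weakly_exposed u f).
  assert (Horbits : almost_transitive X) by now apply (uniformly_convex_almost_transitive u f).
  destruct (duality_form_exists (X := X)) as [B HB]; auto.
  { intros x Hx. now apply (bicontractive_coordinate_everywhere u f). }
  apply (duality_form_hilbert B); auto. intros v w. now apply form_sym.
Qed.
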